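(* Let $F,G\in\mathcal O[x]$ be monic separable polynomials such that $F\equiv G\pmod{\mathfrak m^{\delta(F)+1}}$, where $\delta(F)=v(\operatorname{Disc}(F))$. Then $F\approx G$, and any OM factorization $F\approx P_1\cdots P_g$ of $F$ is also an OM factorization $G\approx P_1\cdots P_g$ of $G$.
   Context: $k$ is a field that is complete and locally compact with respect to a discrete valuation $v$, with valuation ring $\mathcal O$ and maximal ideal $\mathfrak m$; $v$ also denotes its extension to an algebraic closure $\bar k$, normalized by $v(k^* )=\mathbb Z$. Congruences of polynomials are coefficientwise. Okutsu equivalence of irreducible polynomials. Let $F\in\mathcal O[x]$ be monic, irreducible and separable of degree $n$, with root $\theta\in\bar k$. Put $m_0=1$, $\phi_0=1$. An Okutsu frame of $F$ is a (possibly empty) list $[\phi_1,\dots,\phi_r]$ of monic separable polynomials in $\mathcal O[x]$ of degrees $1\le m_1<\cdots<m_r<m_{r+1}:=n$ such that $v(\phi_i(\theta))/m_i<v(\phi_{i+1}(\theta))/m_{i+1}$ for $0\le i<r$, and, for $0\le i\le r$ and every monic $g\in\mathcal O[x]$ with $m_i\le\deg g<m_{i+1}$, one has $v(g(\theta))/\deg g\le v(\phi_i(\theta))/m_i$. Okutsu frames exist, and $r$, the $m_i$ and the values $v(\phi_i(\theta))$ ($1\le i\le r$) depend only on $F$. A monic $G\in\mathcal O[x]$ of degree $n$ satisfies $F\approx G$ (Okutsu equivalence) if $v(G(\theta))>\frac{n}{m_r}v(\phi_r(\theta))$; this is an equivalence relation on monic irreducible separable polynomials in $\mathcal O[x]$.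 Okutsu equivalence of arbitrary polynomials. For monic separable $F,G\in\mathcal O[x]$ with factorizations $F=F_1\cdots F_g$, $G=G_1\cdots G_{g'}$ into monic irreducible polynomials of $\mathcal O[x]$, write $F\approx G$ if $g=g'$ and, up to ordering, $F_s\approx G_s$ for all $1\le s\le g$. An Okutsu factorization of $F$ is an expression $F\approx P_1\cdots P_g$ with $P_1,\dots,P_g\in\mathcal O[x]$ monic irreducible and (up to ordering of the irreducible factors $F_1,\dots,F_g$ of $F$) $F_s\approx P_s$ for all $s$. OM factorization. Let $\theta_s\in\bar k$ be a root of $F_s$. The Okutsu factorization $F\approx P_1\cdots P_g$ (with factors labelled so that $F_s\approx P_s$) is an OM factorization of $F$ if $v(P_s(\theta_s))>v(P_s(\theta_t))$ for all $1\le s\ne t\le g$. *)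

(* Defs.v *)
From HB Require Import structures.
From mathcomp Require Import all_boot all_order all_algebra all_field.
From mathcomp Require Import boolp classical_sets filter constructive_ereal.
From mathcomp Require Import topology.

Set Implicit Arguments.
Unset Strict Implicit.
Unset Printing Implicit Defensive.

Import Order.TTheory GRing.Theory Num.Theory.
Local Open Scope ring_scope.

Record valuation (R : realDomainType) (F : fieldType) := Valuation {
  val_fun :> F -> \bar R;
  val_ninfty : forall x, val_fun x != -oo%E;
  val_eq_pinfty : forall x, (val_fun x == +oo%E) = (x == 0);
  valM : forall x y, val_fun (x * y) = (val_fun x + val_fun y)%E;
  val_ultra : forall x y,
    (Order.min (val_fun x) (val_fun y) <= val_fun (x + y))%E }.

(* A discrete valuation is normalized: its value group is all of Z. *)
Definition discrete (F : fieldType) (v : valuation int F) : Prop :=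
  forall n : int, exists x, v x = n%:E.

Section ValuationTheory.
Variables (R : realDomainType) (F : fieldType) (v : valuation R F).

Lemma val0 : v 0 = +oo%E.
Proof. by apply/eqP; rewrite val_eq_pinfty. Qed.

Lemma val_idem x : x * x = 1 -> v x = 0%E.
Proof.
have v1 : v 1 = 0%E.
  have := valM v 1 1; have := val_ninfty v 1; have := val_eq_pinfty v 1.
  rewrite mulr1 oner_eq0; case: (v 1) => [r|//|//] _ _ [] /eqP.
  by rewrite -subr_eq0 opprD addNKr oppr_eq0 => /eqP ->.
move=> xx; have := valM v x x; rewrite xx v1.
case: (v x) => [r|//|//] [] /esym /eqP.
by rewrite -mulr2n mulrn_eq0 => /eqP ->.
Qed.

Lemma valN x : v (- x) = v x.
Proof. by rewrite -mulN1r valM (@val_idem (-1)) ?add0e// mulrNN mulr1. Qed.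

End ValuationTheory.

(* The field [F] endowed with the uniform structure (hence the topology)
   defined by [v]: its basic entourages are the sets of pairs [(x, y)] with
   [v (x - y) >= c]. *)
Definition valued_space (R : realDomainType) (F : fieldType)
  (v : valuation R F) : Type := F.

Section ValuedSpace.
Variables (R : realDomainType) (F : fieldType) (v : valuation R F).
Local Open Scope classical_set_scope.
Local Open Scope relation_scope.

Definition val_entourage : set_system (valued_space v * valued_space v) :=
  fun E => exists c : R, forall x y : F, (c%:E <= v (x - y)%R)%E -> E (x, y).

Lemma val_entourage_filter : Filter val_entourage.
Proof.
split; first by exists 0%R.
- move=> A B [a Aa] [b Bb]; exists (Order.max a b) => x y.
  have -> : ((Order.max a b)%:E = Order.max a%:E b%:E)%E.
    by rewrite !maxEle lee_fin; case: ifP.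
  by rewrite ge_max => /andP[ha hb]; split; [exact: Aa|exact: Bb].
- by move=> A B AB [a Aa]; exists a => x y /Aa/AB.
Qed.

Lemma val_entourage_diagonal A : val_entourage A -> diagonal `<=` A.
Proof.
move=> [a Aa] [x y] /= xy; apply: Aa.
by rewrite (xy : x = y) subrr val0 leey.
Qed.

Lemma val_entourage_inv A : val_entourage A -> val_entourage A^-1.
Proof. by move=> [a Aa]; exists a => x y; rewrite -valN opprB => /Aa. Qed.

Lemma val_entourage_split A :
  val_entourage A -> exists2 B, val_entourage B & B \; B `<=` A.
Proof.
move=> [a Aa].
exists [set xy | (a%:E <= v (xy.1 - xy.2 : F)%R)%E]; first by exists a.
move=> [x z] /= [y xy yz]; apply: Aa.
rewrite -(subrK (y : F) x) -addrA; apply: le_trans (val_ultra v _ _).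
by rewrite le_min; apply/andP.
Qed.

HB.instance Definition _ := Choice.copy (valued_space v) F.
HB.instance Definition _ := isPointed.Build (valued_space v) (0 : F).
HB.instance Definition _ := isUniform.Build (valued_space v)
  val_entourage_filter val_entourage_diagonal val_entourage_inv
  val_entourage_split.

(* The defining property of the library's [completeType]. *)
Definition complete_val : Prop :=
  forall A : set_system (valued_space v), ProperFilter A -> cauchy A -> cvg A.

Definition locally_compact_val : Prop := locally_compact [set: valued_space v].

End ValuedSpace.

Definition extends_val (F K : fieldType) (iota : {rmorphism F -> K})
  (v : valuation int F) (w : valuation rat K) : Prop :=
  forall x, w (iota x) = er_map intr (v x).

Definition ideal_mul (A : comNzRingType) (I J : A -> Prop) : A -> Prop :=
  fun x => exists s : seq (A * A),
    (forall ab, ab \in s -> I ab.1 /\ J ab.2) /\ x = \sum_(ab <- s) ab.1 * ab.2.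

(* Irreducible elements of the subring [S] of [A]: with [S] = O[x], these are
   irreducible in O[x] rather than in k[x] (equivalent for monic polynomials). *)
Section Irreducible.
Variables (A : comNzRingType) (S : {pred A}).

Definition unit_in (a : A) : Prop :=
  a \in S /\ exists2 b, b \in S & a * b = 1.

Definition irreducible_in (a : A) : Prop :=
  [/\ a \in S, a != 0, ~ unit_in a &
      forall b c, b \in S -> c \in S -> a = b * c -> unit_in b \/ unit_in c].

End Irreducible.

Definition degp (F : fieldType) (p : {poly F}) : nat := (size p).-1.

(* Discriminant of a monic polynomial.  The library's [resultant p q] is
   [Res(q, p)] in the usual sign convention, so [resultant p^`() p] is the
   product of the values of [p^`()] at the roots of [p], whatever the degree of
   [p^`()]. *)
Definition disc (F : fieldType) (p : {poly F}) : F :=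
  (-1) ^+ 'C(degp p, 2) * resultant p^`() p.

Section Okutsu.
Variables (k : fieldType) (v : valuation int k).

Definition valring : {pred k} := [pred x | (0 <= v x)%E].
Definition valmax : {pred k} := [pred x | (0 < v x)%E].

(* The [n]-th power of the maximal ideal; the zeroth power is the ring. *)
Fixpoint valmax_pow (n : nat) : k -> Prop :=
  if n is n'.+1 then ideal_mul (fun x => x \in valmax) (valmax_pow n')
  else fun x => x \in valring.

Definition congr_pow (n : nat) (F G : {poly k}) : Prop :=
  forall i, valmax_pow n (F`_i - G`_i).

Definition intpoly : {pred {poly k}} := polyOver valring.

Definition irr_intpoly (F : {poly k}) : Prop := irreducible_in intpoly F.

Variables (K : fieldType) (iota : {rmorphism k -> K}) (w : valuation rat K).

Definition valat (g : {poly k}) (theta : K) : \bar rat :=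
  w (map_poly iota g).[theta].

(* [e / n], for [n > 0] *)
Definition ediv (e : \bar rat) (n : nat) : \bar rat := (e * (n%:R^-1)%:E)%E.

(* phi_0 = 1, phi_1, ..., phi_r *)
Definition frame_poly (phis : seq {poly k}) (i : nat) : {poly k} :=
  nth 0 (1 :: phis) i.

(* m_0 = 1, m_1, ..., m_r, m_{r+1} = deg F *)
Definition frame_deg (F : {poly k}) (phis : seq {poly k}) (i : nat) : nat :=
  nth 0%N (1%N :: rcons (map (@degp k) phis) (degp F)) i.

Definition okutsu_frame (F : {poly k}) (theta : K) (phis : seq {poly k}) :
  Prop :=
  let r := size phis in
  let phi := frame_poly phis in
  let m := frame_deg F phis in
  [/\ forall p, p \in phis ->
        [/\ p \is monic, p \in intpoly & separable_poly p],
      (1 <= m 1)%N /\ (forall i, (1 <= i <= r)%N -> (m i < m i.+1)%N),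
      forall i, (i < r)%N ->
        (ediv (valat (phi i) theta) (m i) <
         ediv (valat (phi i.+1) theta) (m i.+1))%E
    & forall i, (i <= r)%N ->
        forall g, g \is monic -> g \in intpoly ->
        (m i <= degp g < m i.+1)%N ->
        (ediv (valat g theta) (degp g) <= ediv (valat (phi i) theta) (m i))%E].

(* Okutsu equivalence, meant for [F] monic, irreducible and separable in O[x].
   Such an [F] has frames, a frame for one root is a frame for all of them, and
   the value compared with [valat G theta] depends neither on the frame nor on
   the root; hence the choice of quantifiers is immaterial. *)
Definition okutsu_irr_equiv (F G : {poly k}) : Prop :=
  [/\ G \is monic, G \in intpoly, degp G = degp F
    & forall theta : K, root (map_poly iota F) theta ->
      exists2 phis, okutsu_frame F theta phis &
        let r := size phis in
        (ediv (valat (frame_poly phis r) theta) (frame_deg F phis r)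
           * (degp F)%:R%:E < valat G theta)%E].

Definition irr_factorization (F : {poly k}) (g : nat)
  (Fs : 'I_g -> {poly k}) : Prop :=
  (forall s, Fs s \is monic /\ irr_intpoly (Fs s)) /\ F = \prod_(s < g) Fs s.

(* "Up to ordering" is absorbed in the choice of the indexing of the factors. *)
Definition okutsu_equiv (F G : {poly k}) : Prop :=
  exists (g : nat) (Fs Gs : 'I_g -> {poly k}),
    [/\ irr_factorization F Fs, irr_factorization G Gs
      & forall s, okutsu_irr_equiv (Fs s) (Gs s)].

(* [F ~ P_1 ... P_g] is an Okutsu factorization, the irreducible factors
   [Fs] of [F] being labelled so that [Fs s ~ P s]. *)
Definition okutsu_factorization (F : {poly k}) (g : nat)
  (Fs P : 'I_g -> {poly k}) : Prop :=
  [/\ irr_factorization F Fs,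
      forall s, P s \is monic /\ irr_intpoly (P s)
    & forall s, okutsu_irr_equiv (Fs s) (P s)].

Definition om_factorization (F : {poly k}) (g : nat) (P : 'I_g -> {poly k}) :
  Prop :=
  exists2 Fs : 'I_g -> {poly k}, okutsu_factorization F Fs P &
    forall s t, s != t -> forall theta_s theta_t : K,
      root (map_poly iota (Fs s)) theta_s ->
      root (map_poly iota (Fs t)) theta_t ->
      (valat (P s) theta_t < valat (P s) theta_s)%E.

End Okutsu.

(* Main.v *)
Require Import Defs.
From HB Require Import structures.
From mathcomp Require Import all_boot all_order all_algebra all_field.
From mathcomp Require Import boolp classical_sets filter constructive_ereal.
From mathcomp Require Import topology.
From mathcomp Require Import ring lra zify.

Set Implicit Arguments.
Unset Strict Implicit.
Unset Printing Implicit Defensive.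

Import Order.TTheory GRing.Theory Num.Theory.
Local Open Scope ring_scope.
(* The lemmas on valuations take precedence over their namesakes. *)
Import Defs.

(** The two polynomials are compared root by root over the algebraic closure.
    Throughout, conjugates cannot be told apart by the valuation ([conj_val]):
    this is the uniqueness of the extension of a complete valuation, and it
    follows from the equivalence of norms on finite-dimensional spaces
    ([coef_bound]).

    Let [th i] be the roots of [F] and let [different i] be the valuation of
    [F^`()] at [th i].  The discriminant is, up to sign, the product of the
    values of [F^`()] at the roots ([resultant_prod]), so that [delta] is the
    sum of the [different i]; each distance between two roots is counted twice
    there, hence no such distance and no [different i] exceeds [delta / 2].  The
    congruence then yields, for each [i], a root [be i] of [G] at distance at
    least [delta + 1 - different i >= delta / 2 + 1] from [th i]
    ([root_matching]).  As [be i] is closer to [th i] than any other root, the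
    value at [be i] of a factor of [F], or at [th i] of a factor of [G], reveals
    whether [i] belongs to that factor; by conjugation invariance the two
    partitions of the indices agree ([factor_matching]).

    Let [f] be an irreducible factor of [F], of degree [n], with root [x], and
    [h] the corresponding factor of [G], with root [y].  Lagrange interpolation
    at the conjugates of [x] bounds the coefficients of every polynomial [g] of
    degree less than [n] in terms of the valuations of [g.[x]] and [f^`().[x]]
    ([coef_ge]).  Consequently optimal polynomials, hence frames, exist
    ([frame_exists]); the number that decides Okutsu equivalence to [f] is at
    most [n] times the valuation of [f^`().[x]] ([threshold_le]); and [g] takes
    values of equal valuation at [x] and [y] ([val_near]), so that [f] and [h]
    have the same frames ([frame_transport]).  Now the valuation of [h.[x]] is
    the distance of [x] and [y] plus the valuation of [f^`().[x]], and this is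
    more than [n] times the latter because [delta] includes the contributions
    of all the conjugates of [x] ([near_cell]).  So [f] and [h] are
    equivalent, and [h] is equivalent to every polynomial that [f] is
    equivalent to.

    For the separation condition of OM factorizations, averaging over conjugates
    turns the values of [P s] at roots of two factors of [F] into the values of
    these factors at a single root of [P s] ([reciprocity]).  Moving from the
    [th i] to the [be i] changes at most one of these values, and only above
    [delta / 2], where it cannot affect the inequality
    ([separation_transfer]). *)

(** * Valuations and integral elements *)

Section Valuations.
Variables (R : realDomainType) (F : fieldType) (w : valuation R F).
Implicit Types (x y : F) (c : R) (p q : {poly F}).

Lemma val1 : w 1 = 0%E.
Proof. by apply: val_idem; rewrite mulr1. Qed.

Lemma val_fine x : x != 0 -> w x = (fine (w x))%:E.
Proof.
move=> x0; rewrite fineK// fin_numE val_ninfty.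
by rewrite (val_eq_pinfty w x).
Qed.

Lemma valX x n : w (x ^+ n) = (w x *+ n)%E.
Proof.
elim: n => [|n IH]; first by rewrite expr0 val1.
by rewrite exprS valM IH; case: n {IH} => //=; rewrite adde0.
Qed.

Lemma val_prod (I : Type) (r : seq I) (P : pred I) (f : I -> F) :
  w (\prod_(i <- r | P i) f i) = (\sum_(i <- r | P i) w (f i))%E.
Proof. by apply: (big_morph _ (valM w) val1). Qed.

Lemma valB x y : w (x - y) = w (y - x).
Proof. by rewrite -valN opprB. Qed.

Lemma valD_ge x y (a : \bar R) : (a <= w x -> a <= w y -> a <= w (x + y)%R)%E.
Proof.
move=> ax ay; apply: le_trans (val_ultra w x y).
by rewrite le_min ax ay.
Qed.

Lemma valD_gt x y (a : \bar R) : (a < w x -> a < w y -> a < w (x + y)%R)%E.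
Proof.
move=> ax ay; apply: lt_le_trans (val_ultra w x y).
by rewrite lt_min ax ay.
Qed.

Lemma valB_ge x y (a : \bar R) : (a <= w x -> a <= w y -> a <= w (x - y)%R)%E.
Proof. by move=> ax ay; apply: valD_ge => //; rewrite valN. Qed.

Lemma val_sum_ge (I : Type) (r : seq I) (P : pred I) (f : I -> F) (a : \bar R) :
  (forall i, P i -> a <= w (f i))%E -> (a <= w (\sum_(i <- r | P i) f i)%R)%E.
Proof.
move=> h; elim/big_rec : _ => [|i x Pi ax]; first by rewrite val0 leey.
by apply: valD_ge => //; exact: h.
Qed.

Lemma val_sum_gt (I : Type) (r : seq I) (P : pred I) (f : I -> F) c :
  (forall i, P i -> c%:E < w (f i))%E -> (c%:E < w (\sum_(i <- r | P i) f i)%R)%E.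
Proof.
move=> h; elim/big_rec : _ => [|i x Pi ax]; first by rewrite val0 ltry.
by apply: valD_gt => //; exact: h.
Qed.

(** The isosceles principle. *)
Lemma valD_lt x y : (w x < w y)%E -> w (x + y) = w x.
Proof.
move=> xy; apply/le_anti/andP; split; last by apply: valD_ge => //; exact: ltW.
rewrite leNgt; apply/negP => lt.
suff: (w x < w x)%E by rewrite ltxx.
by rewrite -{2}(addrK y x); apply: valD_gt => //; rewrite valN.
Qed.

Lemma val_eq_near x y : (w x < w (y - x)%R)%E -> w y = w x.
Proof. by move=> h; rewrite -(valD_lt h) addrC subrK. Qed.

Definition integers : {pred F} := [pred x | (0 <= w x)%E].

Lemma integers_subring : subring_closed integers.
Proof.
split; first by rewrite inE val1.
- by move=> x y; rewrite !inE => hx hy; apply: valB_ge.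
- by move=> x y; rewrite !inE => hx hy; rewrite valM adde_ge0.
Qed.
HB.instance Definition _ := GRing.isSubringClosed.Build F integers
  integers_subring.

Lemma val_horner_ge p x c : x \in integers -> (forall i, c%:E <= w p`_i)%E ->
  (c%:E <= w p.[x])%E.
Proof.
move=> xO pc; rewrite horner_coef; apply: val_sum_ge => i _; rewrite valM.
have /= xi : (0 <= w (x ^+ i)%R)%E by have /(rpredX i) := xO; rewrite inE.
by rewrite -[c%:E]adde0; apply: leeD.
Qed.

Lemma integers_horner p x : p \is a polyOver integers -> x \in integers ->
  p.[x] \in integers.
Proof. by move=> pO xO; apply: rpred_horner. Qed.

(** [x - y] divides [p.[x] - p.[y]] over the integers: polynomials are
    Lipschitz for the valuation. *)
Lemma val_horner_sub p x y c : x \in integers -> y \in integers ->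
  (forall i, c%:E <= w p`_i)%E ->
  (c%:E + w (x - y)%R <= w (p.[x] - p.[y])%R)%E.
Proof.
move=> xO yO pc; rewrite !horner_coef -sumrB; apply: val_sum_ge => i _.
rewrite -mulrBr subrXX !valM; apply: leeD => //.
rewrite -[leLHS]adde0; apply: leeD => //.
apply: val_sum_ge => j _; rewrite valM adde_ge0//.
  by have /(rpredX (i.-1 - j)) := xO; rewrite inE.
by have /(rpredX j) := yO; rewrite inE.
Qed.

Lemma polyOver_ge0 p : p \is a polyOver integers -> forall i, (0%:E <= w p`_i)%E.
Proof. by move=> /polyOverP pO i; have := pO i; rewrite inE. Qed.

(** If [x] were not integral, the leading term would strictly dominate all the
    others. *)
Lemma integers_root p x : p \is monic -> p \is a polyOver integers ->
  root p x -> x \in integers.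
Proof.
move=> pm pO /rootP px; rewrite inE leNgt; apply/negP => x0.
have xn0 : x != 0 by apply: contraTneq x0 => ->; rewrite val0.
have [n sp] : exists n, size p = n.+1.
  by have := monic_neq0 pm; rewrite -size_poly_eq0; case: (size p) => // n; exists n.
move: px; rewrite horner_coef sp big_ord_recr /=.
have -> : p`_n = 1 by have /monicP := pm; rewrite lead_coefE sp.
move/eqP; rewrite mul1r addrC addr_eq0 => /eqP xnE.
have w1 : (w (x ^+ n)%R < w (- \sum_(i < n) p`_i * x ^+ i)%R)%E.
  rewrite valN (val_fine (expf_neq0 n xn0)); apply: val_sum_gt => i _.
  rewrite -val_fine ?expf_neq0// valM; apply: (@lt_le_trans _ _ (w (x ^+ i)%R)).
    have -> : x ^+ n = x ^+ (n - i).-1.+1 * x ^+ i.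
      by rewrite prednK ?subn_gt0// -exprD subnK// ltnW.
    have neg m : (w (x ^+ m.+1)%R < 0)%E.
      elim: m => [|m IH]; first by rewrite expr1.
      by rewrite exprS valM -[0%E]adde0; apply: lteD.
    by rewrite valM (val_fine (expf_neq0 i xn0)) gteDr ?neg.
  by rewrite -[leLHS]add0e; apply: leeD => //; exact: polyOver_ge0.
by move: w1; rewrite -xnE ltxx.
Qed.

Lemma prod_XsubC_integers (I : Type) (r : seq I) (P : pred I) (a : I -> F) :
  (forall i, P i -> a i \in integers) ->
  \prod_(i <- r | P i) ('X - (a i)%:P) \is a polyOver integers.
Proof. by move=> aO; apply: rpred_prod => i Pi; rewrite polyOverXsubC aO. Qed.

End Valuations.

(** * Resultants and values at roots *)

Section Resultant.
Variable K : fieldType.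

Lemma size_prod_XsubC_ord n (a : 'I_n -> K) :
  size (\prod_i ('X - (a i)%:P)) = n.+1.
Proof. by rewrite size_prod_XsubC [index_enum _]unlock -enumT size_enum_ord. Qed.

(** Multiplying the Sylvester matrix by a Vandermonde block, completed by unit
    columns, evaluates its rows at the roots of [P] and makes it block
    triangular; the values of [q] come out of one diagonal block, and the
    other one is unitriangular. *)
Lemma resultant_prod_aux (P q : {poly K}) (a : 'I_(size P).-1 -> K) :
  P = \prod_i ('X - (a i)%:P) -> injective a -> q != 0 ->
  resultant q P = \prod_i q.[a i].
Proof.
set n := (size P).-1 in a *; set d := (size q).-1 => Pa ainj q0.
have Pm : P \is monic by rewrite Pa monic_prod_XsubC.
have sP : size P = n.+1 by rewrite Pa size_prod_XsubC_ord.
have sq : size q = d.+1 by rewrite prednK ?size_poly_gt0.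
pose S : 'M_(n + d) := Sylvester_mx q P.
pose W := \matrix_(j < n, i < n) a i ^+ j.
pose U := \matrix_(j < n + d, i < n) a i ^+ j.
pose E := \matrix_(j < n + d, l < d) ((j == n + l :> nat)%:R : K).
pose A := \matrix_(j < n, i < n) (a i ^+ j * q.[a i]).
pose B := usubmx (S *m E).
pose C := \matrix_(j < d, l < d) ('X^j * P)`_(n + l).
have SV : S *m row_mx U E = block_mx A B 0 C.
  rewrite mul_mx_row -[S *m U]vsubmxK -[S *m E]vsubmxK block_mxEh.
  have evalU (r : {poly K}) i : (size r <= n + d)%N ->
      \sum_(k < n + d) r`_k * U k i = r.[a i].
    by move=> /horner_coef_wide ->; apply: eq_bigr => k _; rewrite mxE.
  have szM (r : {poly K}) m (j : 'I_m) e : size r = e.+1 ->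
      (size ('X^j * r)%R <= m + e)%N.
    move=> sr; rewrite mulrC size_mulXn -?size_poly_gt0 ?sr//.
    by have := ltn_ord j; lia.
  have rowu j k : S (lshift d j) k = ('X^j * q)`_k.
    by rewrite Sylvester_mxE (unsplitK (inl _ j)) coefXnM ltnNge if_neg mulrb.
  have rowd j k : S (rshift n j) k = ('X^j * P)`_k.
    by rewrite Sylvester_mxE (unsplitK (inr _ j)) coefXnM ltnNge if_neg mulrb.
  congr (row_mx (col_mx _ _) (col_mx _ _)); apply/matrixP => j i; rewrite !mxE.
  - under eq_bigr do rewrite rowu.
    by rewrite evalU ?hornerE ?hornerXn// szM.
  - under eq_bigr do rewrite rowd.
    rewrite evalU; last by rewrite addnC szM.
    by rewrite hornerM Pa horner_prod (bigD1 i)//= hornerXsubC subrr mul0r mulr0.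
  - rewrite (bigD1 (rshift n i))//= rowd [E _ _]mxE eqxx mulr1 big1 ?addr0// => k ki.
    rewrite [E _ _]mxE; case: eqP => [ke|]; last by rewrite mulr0.
    by case/negP: ki; apply/eqP/val_inj.
have detW : \det W != 0.
  have -> : W = Vandermonde n (\row_i a i).
    by apply/matrixP => i j; rewrite !mxE.
  rewrite det_Vandermonde; apply/prodf_neq0 => i _; apply/prodf_neq0 => j ij.
  by rewrite !mxE subr_eq0; apply: contraTneq ij => /ainj ->; rewrite ltnn.
have detV : \det (row_mx U E) = \det W.
  have -> : row_mx U E = block_mx W 0 (dsubmx U) 1%:M.
    rewrite -[U in LHS]vsubmxK -[E]vsubmxK block_mxEh.
    congr (row_mx (col_mx _ _) (col_mx _ _)); apply/matrixP => i j; rewrite !mxE//=.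
      by case: eqP => // e; have := ltn_ord i; lia.
    by rewrite eqn_add2l.
  by rewrite det_lblock det1 mulr1.
have detA : \det A = \det W * \prod_i q.[a i].
  have -> : A = W *m diag_mx (\row_i q.[a i]).
    by apply/matrixP => i j; rewrite mul_mx_diag !mxE.
  by rewrite det_mulmx det_diag; under [X in _ * X]eq_bigr do rewrite mxE.
have detC : \det C = 1.
  rewrite det_trig; last first.
    apply/is_trig_mxP => i j ij; rewrite mxE coefXnM; case: ifP => // _.
    by rewrite nth_default// sP; lia.
  apply: big1 => i _; rewrite mxE coefXnM ltnNge leq_addl /= addnK.
  by have /monicP := Pm; rewrite lead_coefE.
apply: (mulIf detW); rewrite -[resultant _ _]/(\det S) -{1}detV -det_mulmx SV.
by rewrite det_ublock detA detC mulr1 mulrC.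
Qed.

Lemma resultant_prod n (a : 'I_n -> K) (q : {poly K}) :
  injective a -> q != 0 ->
  resultant q (\prod_i ('X - (a i)%:P)) = \prod_i q.[a i].
Proof.
set P := \prod_i _ => ainj q0; have Pa : P = \prod_i ('X - (a i)%:P) by [].
have e : n = (size P).-1 by rewrite Pa size_prod_XsubC_ord.
by move: P Pa e => P Pa e; subst n; apply: resultant_prod_aux.
Qed.

End Resultant.

(** * Conjugation invariance of the valuation *)

Section Completeness.
Variables (k : fieldType) (v : valuation int k).
Local Open Scope classical_set_scope.

Lemma complete_seq (u : nat -> k) : complete_val v ->
  (forall c : int, exists N, forall m n, (N <= m)%N -> (N <= n)%N ->
     (c%:E <= v (u m - u n)%R)%E) ->
  exists l, forall c : int, exists N, forall n, (N <= n)%N ->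
     (c%:E <= v (l - u n)%R)%E.
Proof.
move=> vc uc; pose s : nat -> valued_space v := u.
have: cauchy (s @ \oo).
  move=> A [c cA]; have [N hN] := uc c.
  exists (s @` [set n | (N <= n)%N], s @` [set n | (N <= n)%N]) => /=.
    by split; exists N => // n /= Nn; exists n.
  by move=> [x y] /= [[m Nm <-] [n Nn <-]]; apply/cA/hN.
move=> /(vc _ (fmap_proper_filter _ _)) /cvg_entourage lP.
set l := lim _ in lP; exists (l : k) => c.
have /lP [N _ hN] : entourage
    [set xy : valued_space v * valued_space v |
     (c%:E <= v ((xy.1 : k) - (xy.2 : k))%R)%E].
  by exists c.
by exists N => n Nn; apply: hN.
Qed.

End Completeness.

Section ConjugateInvariance.
Variables (k : fieldType) (v : valuation int k) (v_complete : complete_val v).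
Variables (K : fieldType) (iota : {rmorphism k -> K}) (w : valuation rat K).
Hypothesis w_extends : extends_val iota v w.
Implicit Types (p q g : {poly k}) (x y t : K).
Local Notation ev p x := ((map_poly iota p).[x]).

Lemma w_iota_ge (x : k) (c : int) :
  ((c%:~R : rat)%:E <= w (iota x))%E = (c%:E <= v x)%E.
Proof.
rewrite w_extends; case: (v x) => [r||] /=; last by rewrite !leeNy_eq.
  by rewrite !lee_fin ler_int.
by rewrite !leey.
Qed.

Lemma iota_integers (x : k) : (iota x \in integers w) = (x \in integers v).
Proof. by rewrite !inE -(w_iota_ge x 0). Qed.

Lemma val_large_eq0 x : (forall n : nat, (n%:R : rat)%:E <= w x)%E -> x = 0.
Proof.
move=> h; apply/eqP; apply/negP => /negP /(val_fine w) e.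
have := h ((Num.truncn (fine (w x))).+1); rewrite e lee_fin leNgt.
by rewrite truncnS_gt.
Qed.

(** All norms on a finite-dimensional space over a complete field are
    equivalent, here for the polynomials of degree less than [n] normed by
    their value at [t]: that value bounds the coefficients.  By induction, the
    polynomials of degree less than [n] form a complete subspace, so that
    [t ^+ n] is at positive distance from it. *)
Lemma coef_bound t n : t \in integers w ->
  (forall p, p != 0 -> (size p <= n)%N -> ev p t != 0) ->
  exists2 C : rat, 0 <= C & forall p, (size p <= n)%N ->
    forall i, (w (ev p t) <= C%:E + w (iota p`_i))%E.
Proof.
move=> tO; elim: n => [|n IH] free.
  exists 0 => // p; rewrite leqn0 size_poly_eq0 => /eqP -> i.
  by rewrite coef0 !rmorph0 val0 leey.
have [p p0 sp|C C0 hC] := IH; first by apply: free => //; exact: leqW.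
have evX m : ev 'X^m t = t ^+ m by rewrite map_polyXn hornerXn.
have [B B0 hB] : exists2 B : rat, 0 <= B &
    forall q, (size q <= n)%N -> (w (ev ('X^n + q) t) <= B%:E)%E.
  apply: contrapT => noB.
  have /choice [q hq] (j : nat) : exists q : {poly k}, (size q <= n)%N /\
      ((j%:R : rat)%:E <= w (ev ('X^n + q) t))%E.
    apply: contrapT => noq; apply: noB; exists j%:R => // q sq.
    by rewrite leNgt; apply/negP => /ltW le; apply: noq; exists q.
  (* The sum of ['X^n] and [q j] takes at [t] a value tending to 0; by
     induction the coefficients of the [q j] are Cauchy sequences, and their
     limits define a polynomial whose sum with ['X^n] vanishes at [t]. *)
  have cau i : exists l, forall c : int, exists N, forall j, (N <= j)%N ->
      (c%:E <= v (l - (q j)`_i)%R)%E.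
    apply: complete_seq => // c; exists ((Num.truncn (c%:~R + C)).+1) => m j Nm Nj.
    have le (a : nat) : ((Num.truncn (c%:~R + C)).+1 <= a)%N -> c%:~R + C <= a%:R.
      by move=> h; apply/ltW/(lt_le_trans (truncnS_gt _)); rewrite ler_nat.
    rewrite -w_iota_ge -coefB.
    have := hC (q m - q j) _ i.
    rewrite (leq_trans (size_polyD _ _))// ?size_polyN ?geq_max ?(hq _).1//.
    move=> /(_ isT).
    have -> : ev (q m - q j) t = ev ('X^n + q m) t - ev ('X^n + q j) t.
      by rewrite -hornerN -hornerD -rmorphB; congr ((map_poly _ _).[_]); ring.
    move=> h; have {}h := le_trans _ h.
    have : ((c%:~R + C)%:E <= C%:E + w (iota (q m - q j)`_i))%E.
      apply: h; apply: valB_ge; apply: le_trans (hq _).2; rewrite lee_fin;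
      exact: le.
    by rewrite addrC EFinD leeD2lE.
  have [l hl] := choice cau; pose ql := \poly_(i < n) l i.
  have sql : (size ql <= n)%N by exact: size_poly.
  have : 'X^n + ql != 0.
    rewrite -size_poly_eq0 size_polyDl ?size_polyXn//.
  move=> /free; rewrite size_polyDl ?size_polyXn// => /(_ (leqnn _)) /eqP; apply.
  apply: val_large_eq0 => c.
  have [N hN] : exists N, forall j, (N <= j)%N -> forall i, (i < n)%N ->
      ((c : int)%:E <= v (l i - (q j)`_i)%R)%E.
    elim: (n) => [|m [N hN]]; first by exists 0%N.
    have [N' hN'] := hl m c; exists (maxn N N') => j; rewrite geq_max => /andP[? ?] i.
    by rewrite ltnS leq_eqVlt => /predU1P[->|]; [exact: hN'|exact: hN].
  pose j := maxn N c.
  have -> : 'X^n + ql = ('X^n + q j) + (ql - q j) by ring.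
  rewrite rmorphD hornerD; apply: valD_ge.
    by apply: le_trans (hq j).2; rewrite lee_fin ler_nat leq_maxr.
  apply: val_horner_ge => // i; rewrite coef_map coefB coef_poly.
  case: ifP => [i_n|/negbT].
    by have := hN j (leq_maxl _ _) i i_n; rewrite -w_iota_ge.
  rewrite -leqNgt => ni; rewrite (nth_default _ (leq_trans (hq j).1 ni)).
  by rewrite subrr raddf0 val0 leey.
exists (B + C) => [|p sp i]; first exact: addr_ge0.
pose c := p`_n; pose r := p - c *: 'X^n.
have sr : (size r <= n)%N.
  apply/leq_sizeP => m nm; rewrite coefB coefZ coefXn.
  move: nm; rewrite leq_eqVlt => /predU1P[<-|nm]; first by rewrite eqxx mulr1 subrr.
  by rewrite gtn_eqF// mulr0 subr0 nth_default// (leq_trans sp).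
have pE : p = c *: 'X^n + r by rewrite /r addrC subrK.
have wc : (w (ev p t) <= B%:E + w (iota c))%E.
  have [c0|c0] := eqVneq c 0; first by rewrite c0 rmorph0 val0 leey.
  have -> : p = c *: ('X^n + c^-1 *: r) by rewrite scalerDr scalerA divff// scale1r.
  rewrite map_polyZ hornerZ valM addeC; apply: leeD => //; apply: hB.
  by rewrite (leq_trans (size_scale_leq _ _)).
have B0' : (0 <= B%:E)%E by rewrite lee_fin.
have C0' : (0 <= C%:E)%E by rewrite lee_fin.
have [ni|ni|->] := ltngtP i n; last 1 first.
- apply: le_trans wc _; apply: leeD => //; rewrite lee_fin.
  by rewrite lerDl.
- have -> : p`_i = r`_i by rewrite pE coefD coefZ coefXn ltn_eqF// mulr0 add0r.
  rewrite EFinD -addeA -leeBlDl//; apply: le_trans _ (hC r sr i).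
  have -> : ev r t = ev p t - iota c * t ^+ n.
    by rewrite /r rmorphB hornerD hornerN /= map_polyZ hornerZ evX.
  apply: valB_ge; first by rewrite leeBlDl// leeDr.
  rewrite leeBlDl// valM; apply: le_trans wc _; apply: leeD => //.
  by rewrite leeDl//; have /(rpredX n) := tO; rewrite inE.
- by rewrite (nth_default _ (leq_trans sp ni)) rmorph0 val0 leey.
Qed.

Lemma irreducible_dvd f g x : irreducible_poly f ->
  root (map_poly iota f) x -> root (map_poly iota g) x -> f %| g.
Proof.
case=> _ firr fx gx; have [sg|sg] := eqVneq (size (gcdp f g)) 1%N.
  have : coprimep (map_poly iota f) (map_poly iota g) by rewrite coprimep_map coprimep_def sg.
  by move=> /coprimep_root /(_ fx); rewrite -rootE gx.
by rewrite -(eqp_dvdl _ (firr _ sg (dvdp_gcdl f g))) dvdp_gcdr.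
Qed.

Lemma irreducible_neq0 f p x : irreducible_poly f ->
  root (map_poly iota f) x -> p != 0 -> (size p < size f)%N -> ev p x != 0.
Proof.
move=> firr fx p0 sp; rewrite -rootE; apply: contraL sp => px.
by rewrite -leqNgt dvdp_leq// (irreducible_dvd firr fx).
Qed.

(** Conjugates are indistinguishable for the valuation.  Powers of [g.[x]] are
    the values at [x] of polynomials of bounded degree; their coefficients,
    hence their values at [y], are almost as divisible as their values at
    [x], and the error disappears in the limit. *)
Lemma conj_val_le f g x y : irreducible_poly f -> f \is monic ->
  f \is a polyOver (integers v) ->
  root (map_poly iota f) x -> root (map_poly iota f) y ->
  (w (ev g x) <= w (ev g y))%E.
Proof.
move=> firr fm fO fx fy.
have fO' : map_poly iota f \is a polyOver (integers w).
  by apply/polyOverP => i; rewrite coef_map iota_integers; apply: (polyOverP fO).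
have xO := integers_root (monic_map iota fm) fO' fx.
have yO := integers_root (monic_map iota fm) fO' fy.
have [gy0|gy0] := eqVneq (ev g y) 0; first by rewrite gy0 val0 leey.
have gx0 : ev g x != 0.
  apply: contra gy0 => gx; have /dvdpP [h ->] := irreducible_dvd firr fx gx.
  by rewrite rmorphM hornerM (rootP fy) mulr0.
have s1 : (size f).-1.+1 = size f by rewrite prednK// size_poly_gt0 irredp_neq0.
have [||C C0 hC] := @coef_bound x (size f).-1 => //.
  by move=> p p0 sp; rewrite (irreducible_neq0 firr)// -s1.
rewrite (val_fine w gx0) (val_fine w gy0) lee_fin leNgt; apply/negP.
set a := fine _; set b := fine _; rewrite -subr_gt0 => ba.
(* The remainder keeps the values at the roots of [f] and has bounded degree. *)
have le N : N%:R * (b - a) <= C.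
  pose p := (g ^+ N) %% f.
  have pE z : root (map_poly iota f) z -> ev p z = ev g z ^+ N.
    move=> fz; have := congr1 (fun h => ev h z) (divp_eq (g ^+ N) f).
    by rewrite rmorphXn rmorphD rmorphM hornerD hornerM horner_exp (rootP fz) mulr0 add0r.
  have sp : (size p <= (size f).-1)%N.
    by rewrite -ltnS s1 ltn_modp irredp_neq0.
  have wX z : z != 0 -> w (z ^+ N) = (N%:R * fine (w z))%:E.
    move=> z0; rewrite valX {1}(val_fine w z0) -EFin_natmul mulr_natl //.
  have := @val_horner_ge _ _ w (map_poly iota p) y (N%:R * b - C) yO.
  rewrite pE// wX// -/a lee_fin.
  have h i : ((N%:R * b - C)%:E <= w (map_poly iota p)`_i)%E.
    by have := hC p sp i; rewrite pE// wX// coef_map -/b -leeBlDl.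
  by move=> /(_ h); rewrite mulrBr; lra.
have := le ((Num.truncn (C / (b - a))).+1); rewrite -ler_pdivlMr// leNgt.
by rewrite truncnS_gt.
Qed.

Lemma conj_val f g x y : irreducible_poly f -> f \is monic ->
  f \is a polyOver (integers v) ->
  root (map_poly iota f) x -> root (map_poly iota f) y ->
  w (ev g x) = w (ev g y).
Proof. by move=> *; apply/le_anti/andP; split; apply: (@conj_val_le f). Qed.

End ConjugateInvariance.

(** * Values of polynomials of small degree *)

Section SplitPolynomials.
Variable K : fieldType.

Lemma deriv_prod_XsubC_cond (I : finType) (P : pred I) (a : I -> K) i : P i ->
  (\prod_(j | P j) ('X - (a j)%:P))^`().[a i] =
  \prod_(j | P j && (j != i)) (a i - a j).
Proof.
move=> Pi; rewrite (bigD1 i)//= derivM derivXsubC mul1r hornerD hornerM.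
rewrite hornerXsubC subrr mul0r addr0 horner_prod.
by apply: eq_bigr => j _; rewrite hornerXsubC.
Qed.

Lemma deriv_prod_XsubC n (a : 'I_n -> K) i :
  (\prod_j ('X - (a j)%:P))^`().[a i] = \prod_(j | j != i) (a i - a j).
Proof. exact: (@deriv_prod_XsubC_cond _ xpredT). Qed.

Lemma lagrange_interpolation n (a : 'I_n -> K) (g : {poly K}) :
  injective a -> (size g <= n)%N ->
  g = \sum_i (g.[a i] / \prod_(j | j != i) (a i - a j)) *:
        \prod_(j | j != i) ('X - (a j)%:P).
Proof.
move=> ainj sg; apply/eqP; rewrite -subr_eq0; apply/eqP.
apply: (@roots_geq_poly_eq0 _ _ (codom a)).
- apply/allP => _ /codomP [l ->]; rewrite /root hornerD hornerN horner_sum.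
  rewrite (bigD1 l)//= hornerZ horner_prod.
  rewrite [X in _ / _ * X](_ : _ = \prod_(j | j != l) (a l - a j)); last first.
    by apply: eq_bigr => j _; rewrite hornerXsubC.
  rewrite divfK; last first.
    by apply/prodf_neq0 => j jl; rewrite subr_eq0; apply: contra jl => /eqP/ainj->.
  rewrite big1 ?addr0 ?subrr// => i il.
  rewrite hornerZ [X in _ * X](_ : _ = 0) ?mulr0// horner_prod (bigD1 l) /=.
    by rewrite hornerXsubC subrr mul0r.
  by rewrite eq_sym.
- by rewrite map_inj_uniq ?enum_uniq.
rewrite size_codom card_ord (leq_trans (size_polyD _ _))// geq_max sg size_polyN.
apply: (leq_trans (size_sum _ _ _)); apply/bigmax_leqP => i _.
apply: (leq_trans (size_scale_leq _ _)); rewrite -big_filter size_prod_XsubC.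
rewrite size_filter [X in (X < _)%N](_ : _ = #|predC1 i|); last first.
  by rewrite cardE /enum_mem size_filter [index_enum _]unlock.
by rewrite cardC1 card_ord; case: n i {a g ainj sg} => [[]|].
Qed.

End SplitPolynomials.

Lemma separable_split (k : fieldType) (K : closedFieldType)
    (iota : {rmorphism k -> K}) (f : {poly k}) :
  f \is monic -> separable_poly f ->
  exists2 a : 'I_(degp f) -> K, injective a &
    map_poly iota f = \prod_i ('X - (a i)%:P).
Proof.
move=> fm fs; have [r] := closed_field_poly_normal (map_poly iota f).
rewrite (monicP (monic_map iota fm)) scale1r => fr.
have ru : uniq r by rewrite -separable_prod_XsubC -fr separable_map.
have e : degp f = size r by rewrite /degp -(size_map_poly iota) fr size_prod_XsubC.
rewrite e; exists (tnth (in_tuple r)); first exact/tuple_uniqP.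
by rewrite fr -(big_tnth _ _ _ predT (fun z => 'X - z%:P)).
Qed.

Lemma map_resultant_field (k K : fieldType) (iota : {rmorphism k -> K})
  (p q : {poly k}) :
  iota (resultant p q) = resultant (map_poly iota p) (map_poly iota q).
Proof.
rewrite /resultant /Sylvester_mx !size_map_poly -det_map_mx map_col_mx.
by congr (\det (col_mx _ _)); apply: map_lin1_mx => u;
  rewrite map_poly_rV rmorphM /= map_rVpoly.
Qed.

Lemma valV (R : realDomainType) (F : fieldType) (w : valuation R F) x c :
  w x = c%:E -> w x^-1 = (- c)%:E.
Proof.
move=> xc; have x0 : x != 0 by rewrite -(val_eq_pinfty w) xc.
have := valM w x x^-1; rewrite divff// val1 xc (val_fine w (invr_neq0 x0)).
by move=> [] /eqP; rewrite eq_sym addrC addr_eq0 => /eqP ->.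
Qed.

Section IrreducibleIntegral.
Variables (k : fieldType) (v : valuation int k) (v_complete : complete_val v).
Variables (K : closedFieldType) (iota : {rmorphism k -> K}) (w : valuation rat K).
Hypothesis w_extends : extends_val iota v w.
Local Notation ev p x := ((map_poly iota p).[x]).

Lemma map_integers (p : {poly k}) : p \is a polyOver (integers v) ->
  map_poly iota p \is a polyOver (integers w).
Proof.
move=> pO; apply/polyOverP => i; rewrite coef_map (iota_integers w_extends).
exact: (polyOverP pO).
Qed.

Variable f : {poly k}.
Hypotheses (f_irr : irreducible_poly f) (f_monic : f \is monic).
Hypotheses (f_int : f \is a polyOver (integers v)) (f_sep : separable_poly f).
Local Notation rootf x := (root (map_poly iota f) x).

Lemma root_integers x : rootf x -> x \in integers w.
Proof. exact: integers_root (monic_map iota f_monic) (map_integers f_int). Qed.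

Lemma deriv_root_neq0 x : rootf x -> ev f^`() x != 0.
Proof.
move=> fx; have := f_sep; rewrite -(separable_map iota) unlock.
by rewrite deriv_map => /coprimep_root /(_ fx).
Qed.

(** By Lagrange interpolation at the roots of [f], and because these cannot be
    told apart by the valuation, the coefficients of [g] are at least as
    divisible as [g.[x]], up to the different [f^`().[x]]. *)
Lemma coef_ge x (g : {poly k}) i : rootf x -> (size g < size f)%N ->
  (w (ev g x) <= w (iota g`_i) + w (ev f^`() x))%E.
Proof.
move=> fx sg; have [a ainj fa] := separable_split iota f_monic f_sep.
have fra j : rootf (a j).
  by rewrite fa /root horner_prod (bigD1 j)//= hornerXsubC subrr mul0r.
have wf' j : w (ev f^`() (a j)) = w (ev f^`() x).
  exact: (conj_val v_complete w_extends) f_irr _ _ _ _.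
have wg j : w (ev g (a j)) = w (ev g x).
  exact: (conj_val v_complete w_extends) f_irr _ _ _ _.
rewrite -leeBlDr -?(val_fine w (deriv_root_neq0 fx)); last first.
  by rewrite (val_fine w (deriv_root_neq0 fx)).
have sg' : (size (map_poly iota g) <= degp f)%N.
  by rewrite size_map_poly /degp -ltnS prednK// size_poly_gt0 monic_neq0.
rewrite -coef_map [in leRHS](lagrange_interpolation ainj sg') coef_sum.
apply: val_sum_ge => j _; rewrite coefZ valM -deriv_prod_XsubC -fa deriv_map.
rewrite valM wg (valV (val_fine w (deriv_root_neq0 (fra j)))) wf' EFinN.
rewrite -val_fine ?deriv_root_neq0// -[leLHS]adde0; apply: leeD => //.
have /polyOverP/(_ i) := @prod_XsubC_integers _ _ w _ (index_enum _)
  (fun l => l != j) a (fun l _ => root_integers (fra l)).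
by rewrite inE.
Qed.

Lemma val_monic_le x (g : {poly k}) : rootf x -> g \is monic ->
  (size g < size f)%N -> (w (ev g x) <= w (ev f^`() x))%E.
Proof.
move=> fx gm sg; have := coef_ge (degp g) fx sg.
have -> : g`_(degp g) = 1 by have /monicP := gm; rewrite lead_coefE.
by rewrite rmorph1 val1 add0e.
Qed.

(** The coefficients of [g] are almost as divisible as [g.[x]], so that the
    variation of [g] between [x] and [y] is negligible. *)
Lemma val_near x y (g : {poly k}) : rootf x -> y \in integers w ->
  (w (ev f^`() x) < w (x - y)%R)%E -> (size g < size f)%N ->
  w (ev g y) = w (ev g x).
Proof.
move=> fx yO near sg; have [->|g0] := eqVneq g 0; first by rewrite rmorph0 !horner0.
have gx0 := irreducible_neq0 f_irr fx g0 sg; apply: val_eq_near.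
have dx0 := deriv_root_neq0 fx.
set c := fine (w (ev g x)); set l := fine (w (ev f^`() x)).
have h i : ((c - l)%:E <= w (map_poly iota g)`_i)%E.
  rewrite EFinB /c /l -!val_fine// coef_map leeBlDr; first exact: coef_ge.
  by rewrite (val_fine w dx0).
apply: lt_le_trans (val_horner_sub yO (root_integers fx) h).
rewrite valB (val_fine w gx0) -/c -[X in (X < _)%E](_ : (c - l)%:E + l%:E = _)%E.
  by rewrite lteD2lE// /l -val_fine.
by rewrite -EFinD subrK.
Qed.

(** The product of the conjugates of [g.[x]] is a resultant, hence lies in the
    base field: this bounds the ramification. *)
Lemma val_denom x (g : {poly k}) : rootf x -> g != 0 -> (size g < size f)%N ->
  exists z : int, fine (w (ev g x)) * (degp f)%:R = z%:~R.
Proof.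
move=> fx g0 sg; have [a ainj fa] := separable_split iota f_monic f_sep.
have fra j : rootf (a j).
  by rewrite fa /root horner_prod (bigD1 j)//= hornerXsubC subrr mul0r.
have gn0 y : rootf y -> ev g y != 0 by move=> fy; apply: irreducible_neq0 f_irr fy _ _.
have := map_resultant_field iota g f.
rewrite fa resultant_prod ?map_poly_eq0// => /(congr1 w).
rewrite w_extends val_prod; under eq_bigr => j _ do
  rewrite (conj_val v_complete w_extends g f_irr f_monic f_int (fra j) fx) (val_fine w (gn0 _ fx)).
rewrite sumEFin sumr_const card_ord; case: (v _) => [z||]//= [] zE.
by exists z; rewrite zE mulr_natr.
Qed.

End IrreducibleIntegral.

(** * Optimal polynomials and Okutsu frames *)

Section Frames.
Variables (k : fieldType) (v : valuation int k) (v_complete : complete_val v).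
Hypothesis v_discrete : discrete v.
Variables (K : closedFieldType) (iota : {rmorphism k -> K}) (w : valuation rat K).
Hypothesis w_extends : extends_val iota v w.
Local Notation ev p x := ((map_poly iota p).[x]).

Lemma separable_no_common_root (p : {poly k}) :
  (forall x : K, root (map_poly iota p^`()) x -> ev p x != 0) -> separable_poly p.
Proof.
move=> h; rewrite unlock coprimep_sym -(coprimep_map iota).
by apply/Pdiv.ClosedField.coprimepP => x /h.
Qed.

Lemma monic_perturb (p r : {poly k}) : p \is monic -> (size r < size p)%N ->
  p + r \is monic /\ size (p + r) = size p.
Proof.
by move=> pm rp; rewrite qualifE /= lead_coefDl// size_polyDl.
Qed.

(** A suitable small constant makes [p] separable unless [p^`() = 0], in which
    case a small multiple of the variable does. *)
Lemma separable_approx (p : {poly k}) (c : nat) : p \is monic -> (1 < size p)%N ->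
  exists r : {poly k}, [/\ (size r < size p)%N, separable_poly (p + r) &
    forall i, ((c : int)%:E <= v r`_i)%E].
Proof.
move=> pm sp.
have [p'0|p'0] := eqVneq p^`() 0.
  have [t tc] := v_discrete c.
  have t0 : t != 0 by rewrite -(val_eq_pinfty v) tc.
  have sp2 : (2 < size p)%N.
    rewrite ltn_neqAle sp andbT; apply/eqP => sp2.
    have := congr1 (fun q : {poly k} => q`_0) p'0.
    have := monicP pm; rewrite coef_deriv lead_coefE -sp2 coef0 /= => ->.
    by move/eqP; rewrite oner_eq0.
  exists (t *: 'X); split.
  - by rewrite size_scale// size_polyX.
  - rewrite unlock derivD p'0 add0r derivZ derivX.
    by rewrite coprimepZr// coprimep1.
  - move=> i; rewrite coefZ coefX; case: eqP => _; first by rewrite mulr1 tc.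
    by rewrite mulr0 val0 leey.
have [r rE] := closed_field_poly_normal (map_poly iota p^`()).
have [B hB] : exists B : nat, forall x, x \in r -> fine (w (ev p x)) < B%:R.
  elim: r {rE} => [|x r [B hB]]; first by exists 0%N.
  exists (maxn B (Num.truncn (fine (w (ev p x)))).+1) => y.
  rewrite inE => /predU1P[->|/hB yB].
    by apply: lt_le_trans (truncnS_gt _) _; rewrite ler_nat leq_maxr.
  by apply: lt_le_trans yB _; rewrite ler_nat leq_maxl.
have [t tB] := v_discrete (maxn B c).
exists t%:P; split.
- by rewrite (leq_ltn_trans (size_polyC_leq1 _)).
- apply: separable_no_common_root => x; rewrite derivD derivC addr0 => p'x.
  have xr : x \in r.
    move: p'x; rewrite rE rootZ ?root_prod_XsubC//.
    by rewrite lead_coef_eq0 map_poly_eq0.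
  rewrite rmorphD hornerD /= map_polyC hornerC addr_eq0; apply/negP => /eqP e.
  have := hB x xr; rewrite e valN w_extends tB /= ltNge ler_nat.
  by rewrite leq_maxl.
move=> i; rewrite coefC; case: ifP => _; last by rewrite val0 leey.
by rewrite tB lee_fin lez_nat leq_maxr.
Qed.

Variable f : {poly k}.
Hypotheses (f_irr : irreducible_poly f) (f_monic : f \is monic).
Hypotheses (f_int : f \is a polyOver (integers v)) (f_sep : separable_poly f).
Variable x : K.
Hypothesis fx : root (map_poly iota f) x.

Lemma size_degp (g : {poly k}) : g \is monic -> size g = (degp g).+1.
Proof. by move=> gm; rewrite prednK// size_poly_gt0 monic_neq0. Qed.

Lemma valat_fin (g : {poly k}) : g \is monic -> (degp g < degp f)%N ->
  valat iota w g x = (fine (valat iota w g x))%:E.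
Proof.
move=> gm sg; apply/val_fine/(irreducible_neq0 f_irr fx); first exact: monic_neq0.
by rewrite !size_degp.
Qed.

(** The values at [x] of the monic integral polynomials of a given degree are
    bounded by the different and have a bounded denominator, so that one of
    them is maximal; a perturbation makes the optimal polynomial separable. *)
Lemma optimal_poly m : (0 < m < degp f)%N ->
  exists phi : {poly k}, [/\ phi \is monic, phi \in intpoly v, separable_poly phi,
    degp phi = m & forall g : {poly k}, g \is monic -> g \in intpoly v ->
      degp g = m -> (valat iota w g x <= valat iota w phi x)%E].
Proof.
move=> /andP[m0 mf].
have f0 : 0 < (degp f)%:R :> rat by rewrite ltr0n (leq_trans _ mf).
have xO := root_integers w_extends f_monic f_int fx.
pose cand (g : {poly k}) := [/\ g \is monic, g \in intpoly v & degp g = m].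
have candX : cand 'X^m.
  split; [exact: monicXn| |by rewrite /degp size_polyXn].
  by rewrite /intpoly -[valring v]/(integers v) polyOverXn.
pose P := [pred z : nat | `[< exists2 g, cand g &
  fine (valat iota w g x) * (degp f)%:R = z%:R >]].
have candP g : cand g -> exists2 z : nat, P z &
    fine (valat iota w g x) * (degp f)%:R = z%:R.
  move=> [gm gO gd].
  have sg : (size g < size f)%N by rewrite !size_degp// gd.
  have [z zE] := val_denom v_complete w_extends f_irr f_monic f_int f_sep fx (monic_neq0 gm) sg.
  have : 0 <= fine (valat iota w g x) * (degp f)%:R.
    apply: mulr_ge0 => //; apply: fine_ge0.
    by have := integers_horner (map_integers w_extends gO) xO; rewrite inE.
  rewrite /valat zE ler0z; case: z zE => // z zE _; exists z => //=.
  by apply/asboolP; exists g.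
have exP : exists z, P z by have [z] := candP _ candX; exists z.
pose L := fine (w (ev f^`() x)) * (degp f)%:R.
have leP z : P z -> (z <= (Num.truncn L).+1)%N.
  move=> /asboolP [g [gm gO gd] zE]; rewrite -(ler_nat rat) -zE.
  apply/ltW/(le_lt_trans _ (truncnS_gt _)); rewrite ler_pM2r//.
  apply: fine_le.
  - by rewrite (valat_fin gm)// gd.
  - by rewrite (val_fine w (deriv_root_neq0 f_sep fx)).
  - by apply: (val_monic_le v_complete w_extends); rewrite ?size_degp// gd.
case: (ex_maxnP exP leP) => z /asboolP [phi0 [pm pO pd] zE] zmax.
have {leP exP} max g : cand g -> (valat iota w g x <= valat iota w phi0 x)%E.
  move=> gc; have [z' /zmax zz' z'E] := candP _ gc; case: gc => gm _ gd.
  rewrite (valat_fin gm) ?gd// (valat_fin pm) ?pd// lee_fin.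
  by rewrite -(ler_pM2r f0) zE z'E ler_nat.
have sp : (1 < size phi0)%N by rewrite size_degp// pd.
have [r [sr rs rc]] := separable_approx (Num.truncn (fine (valat iota w phi0 x))).+1 pm sp.
have [prm prs] := monic_perturb pm sr.
exists (phi0 + r); split => //.
- change (phi0 + r \is a polyOver (integers v)).
  apply: rpredD => //; apply/polyOverP => i; rewrite inE /=.
  by apply: le_trans (rc i); rewrite lee_fin.
- by rewrite /degp prs.
- move=> g gm gO gd; apply: le_trans (max g _) _ => //.
  rewrite {2}/valat rmorphD hornerD valD_lt//.
  rewrite -/(valat iota w phi0 x) (valat_fin pm) ?pd//.
  have h i : (((Num.truncn (fine (valat iota w phi0 x))).+1%:R : rat)%:E <=
               w (map_poly iota r)`_i)%E.
    by rewrite coef_map pmulrn (w_iota_ge w_extends).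
  by apply: lt_le_trans (val_horner_ge xO h); rewrite lte_fin truncnS_gt.
Qed.

End Frames.

Section FrameLists.
Variables (k : fieldType) (v : valuation int k) (v_complete : complete_val v).
Hypothesis v_discrete : discrete v.
Variables (K : closedFieldType) (iota : {rmorphism k -> K}) (w : valuation rat K).
Hypothesis w_extends : extends_val iota v w.
Local Notation ev p x := ((map_poly iota p).[x]).
Implicit Types (F f : {poly k}) (phis : seq {poly k}).

Lemma frame_deg_le F phis i : (i <= size phis)%N ->
  frame_deg F phis i = nth 0%N (1%N :: map (@degp k) phis) i.
Proof.
by case: i => //= i ir; rewrite /frame_deg /= nth_rcons size_map ir.
Qed.

Lemma frame_deg_last F phis : frame_deg F phis (size phis).+1 = degp F.
Proof. by rewrite /frame_deg /= nth_rcons size_map ltnn eqxx. Qed.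

Lemma frame_degS F phis i : (0 < i <= size phis)%N ->
  frame_deg F phis i = degp (frame_poly phis i).
Proof.
by move=> /andP[]; case: i => // i _ ir; rewrite frame_deg_le//= (nth_map 0).
Qed.

Lemma frame_deg_rcons F F' phis phi i : (i <= (size phis).+1)%N ->
  degp phi = degp F' ->
  frame_deg F (rcons phis phi) i = frame_deg F' phis i.
Proof.
move=> ir e; rewrite frame_deg_le ?size_rcons//.
by case: i ir => //= i ir; rewrite /frame_deg /= map_rcons e.
Qed.

Lemma frame_poly_rcons phis phi i : (i <= size phis)%N ->
  frame_poly (rcons phis phi) i = frame_poly phis i.
Proof.
by case: i => //= i ir; rewrite /frame_poly /= nth_rcons ir.
Qed.

Lemma frame_poly_last phis phi :
  frame_poly (rcons phis phi) (size phis).+1 = phi.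
Proof. by rewrite /frame_poly /= nth_rcons ltnn eqxx. Qed.

Lemma degpXn n : degp ('X^n : {poly k}) = n.
Proof. by rewrite /degp size_polyXn. Qed.

Lemma irreducible_degp_gt0 f : irreducible_poly f -> (0 < degp f)%N.
Proof. by case=> + _; rewrite /degp; case: (size f) => [|[]]. Qed.

Section Frame.
Variables (F : {poly k}) (x : K) (phis : seq {poly k}).
Hypothesis Fx : okutsu_frame v iota w F x phis.

Lemma frame_deg_bound i : (i <= size phis)%N ->
  (frame_deg F phis i.+1 <= degp F)%N.
Proof.
have [_ [_ incr] _ _] := Fx.
move=> ir; rewrite -(subKn ir); move: (size phis - i)%N (leq_subr i (size phis)) => j.
elim: j => [|j IH] jr; first by rewrite subn0 frame_deg_last.
apply: leq_trans (IH (ltnW jr)); rewrite ltnW//.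
have -> : (size phis - j = (size phis - j.+1).+1)%N by lia.
by apply: incr; lia.
Qed.

Lemma frame_deg_gt0 i : (i <= size phis)%N -> (0 < frame_deg F phis i)%N.
Proof.
have [_ [m1 incr] _ _] := Fx.
case: i => // i; elim: i => [|i IH] ir //.
by apply: leq_trans (IH (ltnW ir)) _; apply/ltnW/incr/andP; split => //; exact: ltnW.
Qed.

Lemma frame_poly_prop i : (i <= size phis)%N ->
  frame_poly phis i \is monic /\ frame_poly phis i \in intpoly v.
Proof.
case: i => [|i] ir.
  split; first exact: monic1.
  change ((1 : {poly k}) \is a polyOver (integers v)); exact: rpred1.
have [/(_ (frame_poly phis i.+1)) h _ _ _] := Fx.
by have [] := h (mem_nth _ ir).
Qed.

Lemma frame_poly_deg i : (0 < degp F)%N -> (i <= size phis)%N ->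
  (degp (frame_poly phis i) < degp F)%N.
Proof.
move=> F0; case: i => [|i] ir; first by rewrite /degp size_poly1.
rewrite -(@frame_degS F)//; have [_ [_ incr] _ _] := Fx.
by apply: leq_trans (incr _ _) (frame_deg_bound _).
Qed.

End Frame.

Lemma ediv_le (a b : \bar rat) m : (a <= b -> ediv a m <= ediv b m)%E.
Proof.
by move=> ab; apply: lee_wpmul2r => //; rewrite lee_fin invr_ge0 ler0n.
Qed.

(** Only the degree of the polynomial enters the definition of its frames, so
    that these can be built degree by degree: an optimal polynomial of degree
    [N] is appended whenever it improves on the last one. *)
Lemma frame_exists f x : irreducible_poly f -> f \is monic ->
  f \is a polyOver (integers v) -> separable_poly f ->
  root (map_poly iota f) x -> exists phis, okutsu_frame v iota w f x phis.
Proof.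
move=> f_irr f_monic f_int f_sep fx.
suff [phis h] : exists phis, okutsu_frame v iota w 'X^(degp f) x phis.
  by exists phis; move: h; rewrite /okutsu_frame /frame_deg degpXn.
have f0 : (0 < degp f)%N by exact: irreducible_degp_gt0.
suff step N : (0 < N <= degp f)%N -> exists phis, okutsu_frame v iota w 'X^N x phis.
  by apply: step; rewrite f0 leqnn.
elim: N => // -[_ _|N IH /andP[_ Nf]].
  exists [::]; split => //.
  - split; first by rewrite /frame_deg /= degpXn.
    by move=> i /andP[i0 i1]; move: i0; rewrite ltnNge i1.
  - move=> [|i]// _ g _ _; rewrite /frame_deg /= degpXn => /andP[g1].
    by rewrite ltnNge g1.
have [|phis Fphi] := IH; first exact: ltnW.
have [phi [phim phiO phis_ phid phimax]] := optimal_poly v_complete v_discrete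
  w_extends f_irr f_monic f_int f_sep fx (m := N.+1) Nf.
pose r := size phis; pose m := frame_deg 'X^(N.+1) phis.
have [phiP [m1 incr] vals opt] := Fphi.
have m_same n i : (i <= r)%N -> frame_deg 'X^n phis i = m i.
  by move=> ir; rewrite /m !frame_deg_le.
have [le|gt] := leP (ediv (valat iota w phi x) N.+1)
                    (ediv (valat iota w (frame_poly phis r) x) (m r)).
- have mlast n : frame_deg 'X^n phis r.+1 = n by rewrite frame_deg_last degpXn.
  exists phis; split => //.
  + split.
      have [r0|r0] := posnP r; first by have := mlast N.+2; rewrite r0 => ->.
      by rewrite m_same.
    move=> i /andP[i0]; rewrite leq_eqVlt => /predU1P[ir|ir].
      rewrite ir in i0 *; rewrite mlast m_same// ltnS ltnW//.
      by rewrite -[X in (_ < X)%N](mlast N.+1) incr// i0 leqnn.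
    by rewrite !m_same ?(ltnW ir)// incr// i0 ltnW.
  + by move=> i ir; rewrite !m_same ?(ltnW ir)//; exact: vals.
  + move=> i; rewrite leq_eqVlt => /predU1P[->|ir] g gm gO.
      rewrite mlast m_same// ltnS => /andP[mg gN].
      move: gN; rewrite leq_eqVlt => /predU1P[gN|gN].
        rewrite gN; apply: le_trans le; apply: ediv_le; exact: phimax.
      by apply: opt => //; rewrite mg mlast.
    rewrite !m_same ?(ltnW ir)// => mg; apply: opt => //; exact: ltnW.
exists (rcons phis phi); rewrite /okutsu_frame size_rcons -/r.
have m_rc i : (i <= r.+1)%N -> frame_deg 'X^(N.+2) (rcons phis phi) i = m i.
  by move=> ir; apply: frame_deg_rcons => //; rewrite phid degpXn.
have mlast : frame_deg 'X^(N.+2) (rcons phis phi) r.+2 = N.+2.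
  by have := frame_deg_last 'X^(N.+2) (rcons phis phi); rewrite size_rcons degpXn.
have mlast' : m r.+1 = N.+1 by rewrite /m frame_deg_last degpXn.
split.
- by move=> p; rewrite mem_rcons inE => /predU1P[->|/phiP].
- split; first by rewrite m_rc.
  move=> i /andP[i0]; rewrite leq_eqVlt => /predU1P[->|ir].
    by rewrite mlast m_rc// mlast'.
  by rewrite !m_rc ?(ltnW ir)// incr// i0.
- move=> i; rewrite ltnS leq_eqVlt => /predU1P[->|ir].
    by rewrite !m_rc// frame_poly_last frame_poly_rcons// mlast'.
  have ir' : (i <= r)%N by exact: ltnW.
  by rewrite !m_rc ?(leqW ir') ?(leqW ir)// !frame_poly_rcons//; exact: vals.
- move=> i; rewrite leq_eqVlt => /predU1P[->|ir] g gm gO.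
    rewrite mlast m_rc// mlast' frame_poly_last ltnS -eqn_leq => /eqP gN.
    by rewrite -gN; apply: ediv_le; exact: phimax.
  rewrite !m_rc ?(ltnW ir)// frame_poly_rcons// => mg; exact: opt.
Qed.

(** The last polynomial of a frame is monic, of positive degree unless it is 1,
    and of degree less than [f], so that [val_monic_le] applies to it. *)
Lemma threshold_le f x phis : irreducible_poly f -> f \is monic ->
  f \is a polyOver (integers v) -> separable_poly f ->
  root (map_poly iota f) x -> okutsu_frame v iota w f x phis ->
  (ediv (valat iota w (frame_poly phis (size phis)) x)
     (frame_deg f phis (size phis)) * (degp f)%:R%:E <= w (ev f^`() x) * (degp f)%:R%:E)%E.
Proof.
move=> f_irr f_monic f_int f_sep fx Ff; set r := size phis.
have f0 : (0 < degp f)%N by exact: irreducible_degp_gt0.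
have [pm pO] := frame_poly_prop Ff (leqnn r).
have pd := frame_poly_deg Ff f0 (leqnn r).
have le : (valat iota w (frame_poly phis r) x <= w (ev f^`() x))%E.
  by apply: (val_monic_le v_complete w_extends) => //; rewrite !size_degp.
apply: lee_wpmul2r; first by rewrite lee_fin.
apply: le_trans le; rewrite /ediv (valat_fin w f_irr f_monic fx pm pd) -EFinM lee_fin.
rewrite ler_piMr ?invf_le1 ?ltr0n ?ler1n ?(frame_deg_gt0 Ff)//.
apply: fine_ge0; have := integers_horner (map_integers w_extends pO)
  (root_integers w_extends f_monic f_int fx).
by rewrite inE.
Qed.

(** Frames only involve values at [x] of polynomials of degree less than that of
    [f], to which [val_near] applies. *)
Lemma frame_transport f f' x y phis : irreducible_poly f -> f \is monic ->
  f \is a polyOver (integers v) -> separable_poly f ->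
  root (map_poly iota f) x -> y \in integers w -> degp f' = degp f ->
  (w (ev f^`() x) < w (x - y)%R)%E ->
  okutsu_frame v iota w f x phis ->
  okutsu_frame v iota w f' y phis /\
  valat iota w (frame_poly phis (size phis)) y =
  valat iota w (frame_poly phis (size phis)) x.
Proof.
move=> f_irr f_monic f_int f_sep fx yO f'd near Ff.
have f0 : (0 < degp f)%N by exact: irreducible_degp_gt0.
have same g : g \is monic -> (degp g < degp f)%N -> valat iota w g y = valat iota w g x.
  move=> gm gd; apply: (val_near v_complete w_extends f_irr) => //.
  by rewrite !size_degp.
have samephi i : (i <= size phis)%N ->
    valat iota w (frame_poly phis i) y = valat iota w (frame_poly phis i) x.
  move=> ir; have [pm _] := frame_poly_prop Ff ir.
  exact: same (frame_poly_deg Ff f0 ir).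
split; last exact: samephi.
have fd i : frame_deg f' phis i = frame_deg f phis i by rewrite /frame_deg f'd.
have [phiP incr vals opt] := Ff; split => //.
- by split => [|i]; rewrite !fd; [case: incr|move=> ir; case: incr => _; exact].
- by move=> i ir; rewrite !fd !samephi ?(ltnW ir)//; exact: vals.
- move=> i ir g gm gO; rewrite !fd samephi// => gd.
  rewrite same//; first exact: opt.
  by case/andP: gd => _ /leq_trans; apply; exact: frame_deg_bound Ff _ ir.
Qed.

End FrameLists.

(** * Factorization of monic integral polynomials *)

Section Factorization.
Variables (k : fieldType) (v : valuation int k).
Variables (K : closedFieldType) (iota : {rmorphism k -> K}) (w : valuation rat K).
Hypothesis w_extends : extends_val iota v w.
Implicit Types (p q : {poly k}).

(** Gauss's lemma: the roots of a factor are integral. *)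
Lemma monic_dvd_integers p q : p \is monic -> p \is a polyOver (integers v) ->
  q \is monic -> q %| p -> q \is a polyOver (integers v).
Proof.
move=> pm pO qm /dvdpP [c pE].
have [r] := closed_field_poly_normal (map_poly iota q).
rewrite (monicP (monic_map iota qm)) scale1r => qE.
apply/polyOverP => i; rewrite -(iota_integers w_extends) -coef_map qE big_seq.
apply/polyOverP: i; apply: prod_XsubC_integers => x xr.
apply: (integers_root (monic_map iota pm) (map_integers w_extends pO)).
by rewrite pE rmorphM /= rootM qE root_prod_XsubC xr orbT.
Qed.

Lemma monic_factor p q : p \is monic -> q %| p ->
  exists q' r, [/\ q' \is monic, r \is monic, q' %= q & p = r * q'].
Proof.
move=> pm qp; have q0 : q != 0 by apply: contraTneq qp => ->; rewrite dvd0p monic_neq0.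
have lq0 : lead_coef q != 0 by rewrite lead_coef_eq0.
pose q' := (lead_coef q)^-1 *: q.
have qq' : q' %= q by rewrite eqp_scale ?invr_neq0.
have q'm : q' \is monic by rewrite qualifE /= lead_coefZ mulVf.
have /dvdpP [r pE] : q' %| p by rewrite (eqp_dvdl _ qq').
by exists q', r; split => //; move: pm; rewrite pE monicMr.
Qed.

Lemma unit_intpoly_size p : unit_in (intpoly v) p -> size p = 1%N.
Proof.
case=> _ [b _ pb]; have : p \is a GRing.unit by apply/unitrPr; exists b.
by rewrite poly_unitE => /andP[/eqP].
Qed.

Lemma irr_intpoly_irreducible p : p \is monic -> irr_intpoly v p ->
  irreducible_poly p.
Proof.
move=> pm [pO p0 pu pirr]; have p1 : size p != 1%N.
  apply/eqP => /eqP/size_poly1P [c c0 pc]; apply: pu; split => //.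
  exists 1; first by change ((1 : {poly k}) \is a polyOver (integers v)); exact: rpred1.
  by rewrite mulr1 pc; move: pm; rewrite pc qualifE /= lead_coefC => /eqP ->.
split; first by rewrite ltn_neqAle eq_sym p1 size_poly_gt0.
move=> q q1 qp; have [q' [r [q'm rm qq' pE]]] := monic_factor pm qp.
have q'p : q' %| p by rewrite pE dvdp_mull.
have rp : r %| p by rewrite pE dvdp_mulr.
rewrite -(eqp_ltrans qq').
have [] := pirr r q' (monic_dvd_integers pm pO rm rp) (monic_dvd_integers pm pO q'm q'p) pE.
  move=> /unit_intpoly_size/eqP/size_poly1P[c c0 rc].
  by rewrite pE rc mul_polyC eqp_sym eqp_scale.
by move=> /unit_intpoly_size; rewrite (eqp_size qq') => /eqP; rewrite (negPf q1).
Qed.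

Lemma irreducible_irr_intpoly p : p \is monic -> p \is a polyOver (integers v) ->
  irreducible_poly p -> irr_intpoly v p.
Proof.
move=> pm pO pirr; split => //; first exact: monic_neq0.
  by move=> /unit_intpoly_size p1; case: pirr; rewrite p1.
have key b c : b \is a polyOver (integers v) -> c \is a polyOver (integers v) ->
    p = b * c -> size b = 1%N -> unit_in (intpoly v) b.
  move=> bO cO pE /eqP/size_poly1P [b0 b00 bE]; split => //.
  exists (lead_coef c)%:P.
    change ((lead_coef c)%:P \is a polyOver (integers v)).
    by rewrite polyOverC; exact: (polyOverP cO).
  by rewrite bE -polyCM -(lead_coefC b0) -bE -lead_coefM -pE (monicP pm).
move=> b c bO cO pE; have [b1|b1] := eqVneq (size b) 1%N.
  by left; apply: key pE b1.
right; apply: (key c b) => //; first by rewrite mulrC.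
have bp : b %| p by rewrite pE dvdp_mulr.
have [b0 c0] : b != 0 /\ c != 0.
  by have := monic_neq0 pm; rewrite pE mulf_eq0 negb_or => /andP.
have := eqp_size (pirr.2 b b1 bp); rewrite pE size_mul//.
move: b0 c0; rewrite -!size_poly_gt0; move: (size b) (size c) => m n; lia.
Qed.

Lemma irr_factorization_exists F : F \is monic -> F \is a polyOver (integers v) ->
  exists (g : nat) (Fs : 'I_g -> {poly k}), irr_factorization v F Fs.
Proof.
move=> Fm FO.
suff [s sP sE] : exists2 s : seq {poly k},
    (forall p, p \in s -> p \is monic /\ irr_intpoly v p) & F = \prod_(p <- s) p.
  exists (size s), (tnth (in_tuple s)); split; last by rewrite sE big_tnth.
  by move=> i; apply: sP; exact: mem_tnth.
have [n] := ubnP (size F); elim: n F Fm FO => // n IH F Fm FO /ltnSE sF.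
have [F1|F1] := eqVneq (size F) 1%N.
  exists [::] => //; rewrite big_nil; move/eqP: F1 => /size_poly1P [c c0 Fc].
  by move: Fm; rewrite Fc qualifE /= lead_coefC => /eqP ->.
have sF1 : (1 < size F)%N by rewrite ltn_neqAle eq_sym F1 size_poly_gt0 monic_neq0.
have [Firr|Fred] := pselect (irreducible_poly F).
  exists [:: F]; last by rewrite big_seq1.
  by move=> p; rewrite inE => /eqP ->; split => //; exact: irreducible_irr_intpoly.
have [q [q1 qF qn]] : exists q, [/\ size q != 1%N, q %| F & ~~ (q %= F)].
  apply: contrapT => no; apply: Fred; split => // q q1 qF.
  by apply/negPn/negP => qn; apply: no; exists q.
have [q' [r [q'm rm qq' FE]]] := monic_factor Fm qF.
have q'F : q' %| F by rewrite FE dvdp_mull.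
have rF : r %| F by rewrite FE dvdp_mulr.
have sq' : (1 < size q')%N.
  by rewrite ltn_neqAle eq_sym (eqp_size qq') q1 -(eqp_size qq') size_poly_gt0 monic_neq0.
have sq'F : (size q' < size F)%N.
  rewrite ltn_neqAle dvdp_leq ?monic_neq0// andbT.
  by rewrite (dvdp_size_eqp q'F) (eqp_ltrans qq').
have sr : (size r < size F)%N.
  rewrite FE size_mul ?monic_neq0//.
  have := monic_neq0 rm; rewrite -size_poly_gt0.
  by move: sq'; move: (size q') (size r) => a b; lia.
have [s sP sE] := IH _ q'm (monic_dvd_integers Fm FO q'm q'F) (leq_trans sq'F sF).
have [s' sP' sE'] := IH _ rm (monic_dvd_integers Fm FO rm rF) (leq_trans sr sF).
exists (s' ++ s); last by rewrite big_cat /= -sE -sE'.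
by move=> p; rewrite mem_cat => /orP[/sP'|/sP].
Qed.

End Factorization.

(** * Matching the roots of two close polynomials *)

Section CloseRoots.
Variables (K : fieldType) (w : valuation rat K).
Variables (N : nat) (th : 'I_N -> K).
Hypotheses (th_inj : injective th) (th_int : forall i, th i \in integers w).
Variable delta : rat.

(** The valuations of the differences of the roots, and of the values of the
    derivative at the roots. *)
Definition gap i j := fine (w (th i - th j)).
Definition different i := \sum_(j | j != i) gap i j.
Hypothesis disc_le : \sum_i different i <= delta.

Lemma gapE i j : j != i -> w (th i - th j) = (gap i j)%:E.
Proof.
by move=> ji; apply: val_fine; rewrite subr_eq0 inj_eq// eq_sym.
Qed.

Lemma gap_ge0 i j : 0 <= gap i j.
Proof.
by apply: fine_ge0; have := rpredB (th_int i) (th_int j); rewrite inE.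
Qed.

Lemma gapC i j : gap i j = gap j i.
Proof. by rewrite /gap valB. Qed.

Lemma gap_le_different i j : j != i -> gap i j <= different i.
Proof.
by move=> ji; rewrite /different (bigD1 j)//= lerDl sumr_ge0// => l _; exact: gap_ge0.
Qed.

Lemma different_ge0 i : 0 <= different i.
Proof. by apply: sumr_ge0 => j _; exact: gap_ge0. Qed.

Lemma different_gap_le i j : j != i -> different i + gap i j <= delta.
Proof.
move=> ji; apply: le_trans disc_le; rewrite (bigD1 i)//= lerD2l.
rewrite (bigD1 j)//= gapC; apply: (@le_trans _ _ (different j)).
  by rewrite gap_le_different// eq_sym.
by rewrite lerDl sumr_ge0// => l _; exact: different_ge0.
Qed.

(** Each distance is counted twice in the discriminant. *)
Lemma different_half i : different i <= delta / 2.
Proof.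
have h : \sum_(j | j != i) gap i j <= \sum_(j | j != i) different j.
  by apply: ler_sum => j ji; rewrite gapC gap_le_different// eq_sym.
have := disc_le; rewrite (bigD1 i)//= => le.
by move: h le; rewrite -/(different i); lra.
Qed.

Lemma gap_half i j : j != i -> gap i j <= delta / 2.
Proof. by move=> ji; apply: le_trans (gap_le_different ji) (different_half i). Qed.

(** Each distance between the two families occurs once in either order. *)
Lemma cross_half (P Q : pred 'I_N) : (forall i, P i -> ~~ Q i) ->
  \sum_(i | P i) \sum_(j | Q j) gap i j <= delta / 2.
Proof.
move=> PQ.
have sub (A B : pred 'I_N) i : (forall i, A i -> ~~ B i) -> A i ->
    \sum_(j | B j) gap i j <= different i.
  move=> AB Ai; rewrite /different [leRHS](bigID B)/= -[leLHS]addr0 lerD//.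
    rewrite le_eqVlt; apply/orP; left; apply/eqP/eq_bigl => j.
    have [Bj|] := boolP (B j); last by rewrite andbF.
    by rewrite andbT; apply/esym; apply: contraTneq Bj => ->; exact: AB.
  by apply: sumr_ge0 => j _; exact: gap_ge0.
have h1 : \sum_(i | P i) \sum_(j | Q j) gap i j <= \sum_(i | P i) different i.
  by apply: ler_sum => i; exact: sub.
have h2 : \sum_(i | P i) \sum_(j | Q j) gap i j <= \sum_(j | Q j) different j.
  rewrite exchange_big /=; apply: ler_sum => j Qj.
  under eq_bigr do rewrite gapC.
  by apply: sub Qj => i Qi; apply/negP => /PQ; rewrite Qi.
have h3 : \sum_(i | P i) different i + \sum_(j | Q j) different j <= \sum_i different i.
  rewrite [leRHS](bigID P)/= lerD2l [leRHS](bigID Q)/= -[leLHS]addr0 lerD//.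
    rewrite le_eqVlt; apply/orP; left; apply/eqP/eq_bigl => j.
    have [Qj|] := boolP (Q j); last by rewrite andbF.
    by rewrite andbT; apply/esym/negP => /PQ; rewrite Qj.
  by apply: sumr_ge0 => j _; exact: different_ge0.
have := disc_le; lra.
Qed.

(** The logarithmic derivative of a product of factors [x - b] is the sum of
    the [(x - b)^-1]. *)
Lemma val_log_deriv (I : Type) (r : seq I) (b : I -> K) x c :
  (forall i, w (x - b i)%R < c%:E)%E ->
  (w (\prod_(i <- r) ('X - (b i)%:P)).[x] <
     c%:E + w (\prod_(i <- r) ('X - (b i)%:P))^`().[x])%E.
Proof.
move=> h; set Q := \prod_(i <- r) _; suff [] : Q.[x] != 0 /\ (w Q.[x] < c%:E + w Q^`().[x])%E by [].
rewrite /Q; elim/big_rec: _ => [|i q _ [q0 IH]].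
  by rewrite hornerC oner_eq0 derivC horner0 val0 val1 addey// ltry.
have xb0 : x - b i != 0.
  by apply: contraTneq (h i) => ->; rewrite val0 -leNgt leey.
rewrite derivM derivXsubC mul1r hornerD !hornerM hornerXsubC mulf_neq0//; split=> //.
move: (h i) IH; rewrite -!lteBlDl// !valM.
have ws := val_fine w q0; have wt := val_fine w xb0; rewrite ws wt.
set s := fine (w q.[x]) in ws *; set t := fine _ in wt * => tc IH.
have {}tc : t < c := tc.
have -> : (t%:E + s%:E - c%:E = t%:E + (s%:E - c%:E))%E by rewrite addeA.
apply: valD_gt; first by rewrite ws -EFinB -EFinD lte_fin; lra.
by rewrite valM wt lteD2lE.
Qed.

(** At a root [x] of the first polynomial, the logarithmic derivative of the
    second one is the sum of the [(x - b)^-1]; its valuation is known and very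
    negative, so that some root [b] is very close to [x].  Distinct roots have
    distinct neighbours because of the size of the discriminant. *)
Lemma root_matching (b : 'I_N -> K) :
  let P := \prod_i ('X - (th i)%:P) in let Q := \prod_i ('X - (b i)%:P) in
  (forall i, (delta + 1)%:E <= w (P - Q)`_i)%E ->
  exists be : 'I_N -> K, [/\ Q = \prod_i ('X - (be i)%:P),
    forall i, exists l, be i = b l &
    forall i, ((delta + 1 - different i)%:E <= w (th i - be i)%R)%E].
Proof.
move=> P Q PQ.
have near i : exists l, ((delta + 1 - different i)%:E <= w (th i - b l)%R)%E.
  apply: contrapT => far.
  have {}far l : (w (th i - b l)%R < (delta + 1 - different i)%:E)%E.
    by rewrite ltNge; apply/negP => h; apply: far; exists l.
  have wQ : ((delta + 1)%:E <= w Q.[th i])%E.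
    have -> : Q.[th i] = - (P - Q).[th i].
      rewrite hornerD hornerN opprB [P.[_]](_ : _ = 0) ?subr0//.
      by rewrite horner_prod (bigD1 i)//= hornerXsubC subrr mul0r.
    by rewrite valN; apply: val_horner_ge.
  have wP' : w P^`().[th i] = (different i)%:E.
    rewrite deriv_prod_XsubC val_prod -sumEFin; apply: eq_bigr => j ji.
    by rewrite gapE.
  have wQ' : ((different i)%:E < w Q^`().[th i])%E.
    have := le_lt_trans wQ (val_log_deriv (index_enum _) far).
    by rewrite -lteBlDl// -EFinB [X in X%:E](_ : _ = different i)//; lra.
  have : ((different i)%:E < w P^`().[th i])%E.
    have -> : P^`().[th i] = Q^`().[th i] + (P - Q)^`().[th i].
      by rewrite -hornerD -derivD addrC subrK.
    apply: valD_gt => //; apply: (@lt_le_trans _ _ (delta + 1)%:E).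
      by have := different_half i; have := different_ge0 i; rewrite lte_fin; lra.
    apply: val_horner_ge => // m; rewrite coef_deriv -mulr_natr.
    have : (0 <= w (m.+1%:R : K))%E by have := rpredMn m.+1 (rpred1 (integers w)); rewrite inE.
    rewrite valM => ?; rewrite -[leLHS]adde0; exact: leeD.
  by rewrite wP' ltxx.
have [l lP] := choice near; exists (b \o l); split => //; last by move=> i; exists (l i).
have linj : injective l.
  move=> i j e; apply: contrapT => /eqP ij; have ji : j != i by rewrite eq_sym.
  have /orP : ((delta + 1 - different i)%:E <= (gap i j)%:E)%E ||
         ((delta + 1 - different j)%:E <= (gap i j)%:E)%E.
    have := lP j; rewrite -e valB => hj; have hi := lP i.
    rewrite -!gapE// -ge_min; have -> : th i - th j = (th i - b (l i)) + (b (l i) - th j).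
      by ring.
    by apply: le_trans (val_ultra _ _ _); rewrite le_min !ge_min hi hj orbT.
  have := different_gap_le ji; have := different_gap_le ij; rewrite [gap j i]gapC.
  by rewrite !lee_fin => ? ? [] ?; clear e; lra.
by rewrite /Q (reindex_inj linj).
Qed.

End CloseRoots.

Lemma sume_const (I : Type) (r : seq I) (P : pred I) (x : \bar rat) :
  (\sum_(i <- r | P i) x = (count P r)%:R%:E * x)%E.
Proof.
rewrite (eq_bigr (fun=> (1%:E * x)%E)); last by move=> i _; rewrite mul1e.
rewrite -ge0_sume_distrl; last by move=> *; rewrite lee_fin.
by rewrite sumEFin big_const_seq iter_addr_0.
Qed.

Section MatchedRoots.
Variables (K : fieldType) (w : valuation rat K).
Variables (N : nat) (th be : 'I_N -> K).
Hypotheses (th_inj : injective th) (th_int : forall i, th i \in integers w).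
Variable delta : rat.
Local Notation gap := (gap w th).
Local Notation different := (different w th).
Hypothesis disc_le : \sum_i different i <= delta.
Hypothesis near : forall i, ((delta + 1 - different i)%:E <= w (th i - be i)%R)%E.
Implicit Types (i j l : 'I_N) (P S T : pred 'I_N).

Lemma near_half i : ((delta / 2 + 1)%:E <= w (th i - be i)%R)%E.
Proof.
apply: le_trans (near i); rewrite lee_fin.
by have := different_half th_int disc_le i; lra.
Qed.

Lemma delta_ge0 i : 0 <= delta / 2.
Proof.
by apply: le_trans (different_half th_int disc_le i); apply: different_ge0.
Qed.

Lemma be_int i : be i \in integers w.
Proof.
rewrite -[be i](subKr (th i)); apply: rpredB => //.
rewrite inE; apply: le_trans (near_half i); rewrite lee_fin.
by have := delta_ge0 i; lra.
Qed.

Section NearPoint.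
Variables (y : K) (i : 'I_N).
Hypothesis yi : ((delta / 2 + 1)%:E <= w (y - th i)%R)%E.

Lemma gap_lt_near j : j != i -> ((gap i j)%:E < (delta / 2 + 1)%:E)%E.
Proof.
move=> ji; have := gap_half th_int disc_le ji.
by rewrite lte_fin; lra.
Qed.

(** A point that is close to the [i]-th root sees the other ones, and their
    neighbours, at the distances at which the [i]-th root sees them. *)
Lemma near_gap_th j : j != i -> w (y - th j) = (gap i j)%:E.
Proof.
move=> ji; have -> : y - th j = (th i - th j) + (y - th i) by ring.
rewrite valD_lt gapE//; exact: lt_le_trans (gap_lt_near ji) yi.
Qed.

Lemma near_be_self : ((delta / 2 + 1)%:E <= w (y - be i)%R)%E.
Proof.
have -> : y - be i = (y - th i) + (th i - be i) by ring.
by apply: valD_ge => //; exact: near_half.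
Qed.

Lemma near_gap_be j : j != i -> w (y - be j) = (gap i j)%:E.
Proof.
move=> ji; have -> : y - be j = (y - th j) + (th j - be j) by ring.
rewrite valD_lt near_gap_th//; apply: lt_le_trans (gap_lt_near ji) (near_half j).
Qed.

Lemma near_sum_th P : P i -> (\sum_(j | P j) w (y - th j)%R =
  w (y - th i)%R + (\sum_(j | P j && (j != i)) gap i j)%:E)%E.
Proof.
move=> Pi; rewrite (bigD1 i)//= -sumEFin; congr (_ + _)%E.
by apply: eq_bigr => j /andP[_ ji]; rewrite near_gap_th.
Qed.

Lemma near_sum_be P : P i -> (\sum_(j | P j) w (y - be j)%R =
  w (y - be i)%R + (\sum_(j | P j && (j != i)) gap i j)%:E)%E.
Proof.
move=> Pi; rewrite (bigD1 i)//= -sumEFin; congr (_ + _)%E.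
by apply: eq_bigr => j /andP[_ ji]; rewrite near_gap_be.
Qed.

Lemma far_sum_th P : ~~ P i ->
  (\sum_(j | P j) w (y - th j)%R = (\sum_(j | P j) gap i j)%:E)%E.
Proof.
move=> Pi; rewrite -sumEFin; apply: eq_bigr => j Pj; rewrite near_gap_th//.
by apply: contraNneq Pi => <-.
Qed.

Lemma far_sum_be P : ~~ P i ->
  (\sum_(j | P j) w (y - be j)%R = (\sum_(j | P j) gap i j)%:E)%E.
Proof.
move=> Pi; rewrite -sumEFin; apply: eq_bigr => j Pj; rewrite near_gap_be//.
by apply: contraNneq Pi => <-.
Qed.

Lemma far_gaps_le P : ~~ P i -> (\sum_(j | P j) gap i j <= delta / 2).
Proof.
move=> Pi; have := @cross_half _ _ _ _ th_int _ disc_le (pred1 i) P.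
by rewrite big_pred1_eq; apply=> l /eqP ->.
Qed.

Lemma near_ge_th P : P i -> ((delta / 2 + 1)%:E <= \sum_(j | P j) w (y - th j)%R)%E.
Proof.
move=> Pi; rewrite near_sum_th// -[leLHS]adde0; apply: leeD => //.
by rewrite lee_fin sumr_ge0// => *; exact: gap_ge0.
Qed.

Lemma near_ge_be P : P i -> ((delta / 2 + 1)%:E <= \sum_(j | P j) w (y - be j)%R)%E.
Proof.
move=> Pi; rewrite near_sum_be// -[leLHS]adde0; apply: leeD.
  exact: near_be_self.
by rewrite lee_fin sumr_ge0// => *; exact: gap_ge0.
Qed.

End NearPoint.

Lemma th_near i : ((delta / 2 + 1)%:E <= w (th i - th i)%R)%E.
Proof. by rewrite subrr val0 leey. Qed.

Lemma be_near i : ((delta / 2 + 1)%:E <= w (be i - th i)%R)%E.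
Proof. by rewrite valB near_half. Qed.

(** Membership of [i] in [P] can be read off the valuation at [be i] or [th i] of
    the product of the linear factors attached to [P]. *)
Lemma be_in_cell i P :
  ((delta / 2 + 1)%:E <= \sum_(j | P j) w (be i - th j)%R)%E = P i.
Proof.
apply/idP/idP => [|Pi]; last exact: near_ge_th (be_near i) _ Pi.
apply: contraTT => Pi; rewrite (far_sum_th (be_near i) Pi) lee_fin -ltNge.
by have := far_gaps_le Pi; lra.
Qed.

Lemma th_in_cell i P :
  ((delta / 2 + 1)%:E <= \sum_(j | P j) w (th i - be j)%R)%E = P i.
Proof.
apply/idP/idP => [|Pi]; last exact: near_ge_be (th_near i) _ Pi.
apply: contraTT => Pi; rewrite (far_sum_be (th_near i) Pi) lee_fin -ltNge.
by have := far_gaps_le Pi; lra.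
Qed.

Lemma be_inj : injective be.
Proof.
move=> i j e; apply/eqP/negP => /negP ij; have ji : j != i by rewrite eq_sym.
have := near_gap_be (th_near i) ji; rewrite -e => e'.
have := near_half i; rewrite e'; apply/negP; rewrite -ltNge.
exact: gap_lt_near.
Qed.

(** The members of [S] are at the same total distance from [T], as is the case
    for conjugates when [T] is stable under conjugation. *)
Definition isotropic S T := forall i i', S i -> S i' ->
  \sum_(j | T j) gap i j = \sum_(j | T j) gap i' j.

Lemma isotropic_le S T i : (forall i, S i -> ~~ T i) -> isotropic S T -> S i ->
  #|S|%:R * \sum_(j | T j) gap i j <= delta / 2.
Proof.
move=> ST iso Si; apply: le_trans (cross_half th_int disc_le ST).
rewrite [leRHS](eq_bigr (fun=> \sum_(j | T j) gap i j)); last first.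
  by move=> l Sl; exact: iso.
by rewrite sumr_const mulr_natl.
Qed.

(** Replacing the [th j] by the [be j] changes the distance to [y] only for an
    index [j] such that [y] is close to [th j].  Such a [j] is not in [T]: the
    distance would exceed what the separation of the two families, which is
    bounded by half of the discriminant, allows under the hypothesis.  If it
    is in [S], this bound yields the conclusion. *)
Lemma separation_transfer S T y : (forall i, S i -> ~~ T i) ->
  isotropic S T -> isotropic T S -> (0 < #|S|)%N -> (0 < #|T|)%N ->
  (#|S|%:R%:E * (\sum_(j | T j) w (y - th j)%R) <
   #|T|%:R%:E * (\sum_(j | S j) w (y - th j)%R))%E ->
  (#|S|%:R%:E * (\sum_(j | T j) w (y - be j)%R) <
   #|T|%:R%:E * (\sum_(j | S j) w (y - be j)%R))%E.
Proof.
move=> ST isoST isoTS S0 T0.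
have scale n (a : \bar rat) : (0 < n)%N -> ((delta / 2 + 1)%:E <= a)%E ->
    0 <= delta / 2 -> ((delta / 2 + 1)%:E <= n%:R%:E * a)%E.
  move=> n0 ha d0; apply: (le_trans ha); rewrite -[leLHS]mul1e.
  apply: lee_wpmul2r; last by rewrite lee_fin ler1n.
  by apply: le_trans ha; rewrite lee_fin; lra.
(* If [y] is close to no root, no distance changes at all. *)
have [[i yi]|far] := pselect (exists i, ((delta / 2 + 1)%:E <= w (y - th i)%R)%E);
    last first.
  have same j : w (y - be j) = w (y - th j).
    have -> : y - be j = (y - th j) + (th j - be j) by ring.
    apply: valD_lt; apply: lt_le_trans (near_half j).
    by rewrite ltNge; apply/negP => h; apply: far; exists j.
  by under eq_bigr do rewrite -same; under [X in (_ < _ * X)%E]eq_bigr do rewrite -same.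
have d0 := delta_ge0 i.
have [Si|nSi] := boolP (S i).
  move=> _; rewrite (far_sum_be yi (ST i Si)) -EFinM.
  apply: lt_le_trans (scale _ _ T0 (near_ge_be yi Si) d0).
  rewrite lte_fin; apply: le_lt_trans (isotropic_le ST isoST Si) _.
  by lra.
have [Ti|nTi] := boolP (T i); last first.
  by rewrite !(far_sum_be yi)// !(far_sum_th yi).
have TS j : T j -> ~~ S j by move=> Tj; apply/negP => /ST; rewrite Tj.
rewrite (far_sum_th yi nSi) -EFinM => lt.
(* For [y] in a cell of [T], the hypothesis itself fails. *)
have : ((delta / 2 + 1)%:E < (delta / 2)%:E)%E.
  apply: le_lt_trans (scale _ _ S0 (near_ge_th yi Ti) d0) _.
  by apply: lt_le_trans lt _; rewrite lee_fin; exact: isotropic_le TS isoTS Ti.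
by rewrite lte_fin gtrDl ltr10.
Qed.

End MatchedRoots.

(** * Matching the irreducible factors *)

Section FactorMatching.
Variables (k : fieldType) (v : valuation int k) (v_complete : complete_val v).
Hypothesis v_discrete : discrete v.
Variables (K : closedFieldType) (iota : {rmorphism k -> K}) (w : valuation rat K).
Hypothesis w_extends : extends_val iota v w.
Local Notation ev p x := ((map_poly iota p).[x]).
Local Notation rt p x := (root (map_poly iota p) x).

Lemma valmax_pow_ge n x : valmax_pow v n x -> ((n : int)%:E <= v x)%E.
Proof.
elim: n x => [|n IH] x //= [s [sI ->]]; rewrite big_seq; apply: val_sum_ge => ab /sI [a1 /IH b1].
rewrite valM intS EFinD; exact: leeD.
Qed.

(** The distances between two sets of conjugates can be averaged over either of
    them. *)
Lemma reciprocity (p q : {poly k}) x y :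
  p \is monic -> irr_intpoly v p -> q \is monic -> irr_intpoly v q ->
  rt p x -> rt q y ->
  ((degp q)%:R%:E * w (ev p y) = (degp p)%:R%:E * w (ev q x))%E.
Proof.
move=> pm pI qm qI px qy.
have pirr := irr_intpoly_irreducible w_extends pm pI.
have qirr := irr_intpoly_irreducible w_extends qm qI.
have [pO _ _ _] := pI; have [qO _ _ _] := qI.
have split r : r \is monic -> exists2 s : seq K,
    degp r = size s & map_poly iota r = \prod_(z <- s) ('X - z%:P).
  move=> rm; have [s] := closed_field_poly_normal (map_poly iota r).
  rewrite (monicP (monic_map iota rm)) scale1r => rE; exists s => //.
  by rewrite /degp -(size_map_poly iota) rE size_prod_XsubC.
have [sp np pE] := split p pm; have [sq nq qE] := split q qm.
have cst r r' z s : r \is monic -> r \is a polyOver (integers v) ->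
    irreducible_poly r -> rt r z -> degp r = size s ->
    map_poly iota r = \prod_(z <- s) ('X - z%:P) ->
    (\sum_(z' <- s) w (ev r' z') = (degp r)%:R%:E * w (ev r' z))%E.
  move=> rm rO rirr rz -> rE; rewrite big_seq (eq_bigr (fun=> w (ev r' z))).
    by rewrite -big_seq sume_const count_predT.
  move=> z' z's; apply: (conj_val v_complete w_extends r' rirr rm rO) => //.
  by rewrite rE root_prod_XsubC.
rewrite -(cst q p y sq)// -(cst p q x sp)//.
have wE r s z : map_poly iota r = \prod_(z <- s) ('X - z%:P) ->
    w (ev r z) = (\sum_(z' <- s) w (z - z')%R)%E.
  move=> ->; rewrite horner_prod val_prod; apply: eq_bigr => z' _.
  by rewrite hornerXsubC.
under eq_bigr do rewrite (wE p sp)//.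
rewrite exchange_big /=; apply: eq_bigr => z _; rewrite (wE q sq)//.
by apply: eq_bigr => z' _; rewrite valB.
Qed.

Lemma dvd_split (N : nat) (a : 'I_N -> K) (F p : {poly k}) :
  injective a -> map_poly iota F = \prod_i ('X - (a i)%:P) ->
  p \is monic -> p %| F ->
  map_poly iota p = \prod_(i | rt p (a i)) ('X - (a i)%:P).
Proof.
move=> ainj FE pm /dvdpP [c Fc].
have [r] := closed_field_poly_normal (map_poly iota p).
rewrite (monicP (monic_map iota pm)) scale1r => pE.
have Fs : separable_poly (map_poly iota F).
  rewrite FE -(big_map a predT (fun z => 'X - z%:P)) separable_prod_XsubC.
  by rewrite map_inj_uniq// [index_enum _]unlock -enumT enum_uniq.
have pF : map_poly iota p %| map_poly iota F by rewrite Fc rmorphM dvdp_mulIr.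
have ru : uniq r by rewrite -separable_prod_XsubC -pE (dvdp_separable pF).
rewrite {1}pE (perm_big [seq a i | i <- enum [pred i | rt p (a i)]]).
  by rewrite big_map big_enum.
apply: uniq_perm => //; first by rewrite map_inj_uniq ?enum_uniq.
move=> z; rewrite -root_prod_XsubC -pE; apply/idP/mapP => [pz|[i]]; last first.
  by rewrite mem_enum => pa ->.
have : root (map_poly iota F) z by rewrite Fc rmorphM /= rootM pz orbT.
rewrite FE /root horner_prod prodf_seq_eq0 => /hasP [i _]; rewrite /= hornerXsubC subr_eq0.
by move=> /eqP zi; exists i => //; rewrite mem_enum inE -zi.
Qed.

Lemma disc_sum_le (F : {poly k}) (th : 'I_(degp F) -> K) (delta : nat) :
  F \is monic -> injective th -> (forall i, th i \in integers w) ->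
  map_poly iota F = \prod_i ('X - (th i)%:P) ->
  v (disc F) = (delta : int)%:E -> \sum_i different w th i <= delta%:R.
Proof.
move=> Fm inj thO FE; have [F'0|F'0] := eqVneq F^`() 0.
  move=> _; rewrite big1 ?ler0n// => i _.
  have := deriv_prod_XsubC th i; rewrite -FE deriv_map F'0 rmorph0 horner0.
  move=> /esym/eqP; rewrite prodf_seq_eq0 => /hasP[j _ /= /andP[ji]].
  by rewrite subr_eq0 => /eqP/inj e; rewrite e eqxx in ji.
have w1 : w ((-1) ^+ 'C(degp F, 2)) = 0%E.
  by apply: val_idem; rewrite -exprD addnn -mul2n exprM sqrrN !expr1n.
move=> vd; have := w_extends (disc F); rewrite vd /disc rmorphM /= valM.
rewrite rmorphXn rmorphN1 w1 add0e map_resultant_field FE.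
rewrite resultant_prod ?map_poly_eq0// val_prod.
rewrite (eq_bigr (fun i => (different w th i)%:E)) => [|i _].
  by rewrite sumEFin => -[] ->.
rewrite -deriv_map FE deriv_prod_XsubC val_prod -sumEFin.
by apply: eq_bigr => j ji; rewrite gapE.
Qed.

Section Matched.
Variables (F G : {poly k}) (N : nat) (th be : 'I_N -> K) (delta : rat).
Hypotheses (F_monic : F \is monic) (G_monic : G \is monic).
Hypotheses (F_int : F \is a polyOver (integers v)) (G_int : G \is a polyOver (integers v)).
Hypotheses (F_sep : separable_poly F) (G_sep : separable_poly G).
Hypotheses (th_inj : injective th) (th_int : forall i, th i \in integers w).
Hypothesis disc_le : \sum_i different w th i <= delta.
Hypothesis near : forall i, ((delta + 1 - different w th i)%:E <= w (th i - be i)%R)%E.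
Hypothesis FE : map_poly iota F = \prod_i ('X - (th i)%:P).
Hypothesis GE : map_poly iota G = \prod_i ('X - (be i)%:P).

Lemma val_ev (P : pred 'I_N) (a : 'I_N -> K) (p : {poly k}) y :
  map_poly iota p = \prod_(i | P i) ('X - (a i)%:P) ->
  w (ev p y) = (\sum_(i | P i) w (y - a i)%R)%E.
Proof.
by move=> ->; rewrite horner_prod val_prod; apply: eq_bigr => i _; rewrite hornerXsubC.
Qed.

Lemma root_in_cell (P : pred 'I_N) (a : 'I_N -> K) (p : {poly k}) y :
  map_poly iota p = \prod_(i | P i) ('X - (a i)%:P) ->
  rt p y -> exists2 i, P i & y = a i.
Proof.
move=> ->; rewrite /root horner_prod prodf_seq_eq0 => /hasP [i _ /= /andP[Pi]].
by rewrite hornerXsubC subr_eq0 => /eqP; exists i.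
Qed.

Lemma root_of_cell (P : pred 'I_N) (a : 'I_N -> K) (p : {poly k}) i :
  map_poly iota p = \prod_(i | P i) ('X - (a i)%:P) -> P i -> rt p (a i).
Proof.
move=> -> Pi; rewrite /root horner_prod (bigD1 i)//= hornerXsubC subrr mul0r//.
Qed.

Lemma factor_dvd g (Fs : 'I_g -> {poly k}) H s : irr_factorization v H Fs -> Fs s %| H.
Proof. by move=> [_ ->]; rewrite (bigD1 s)//= dvdp_mulr. Qed.

Lemma factor_cells g (Fs : 'I_g -> {poly k}) : irr_factorization v F Fs ->
  exists cls : 'I_N -> 'I_g, forall i s, rt (Fs s) (th i) = (cls i == s).
Proof.
move=> FF; have ex i : exists s, rt (Fs s) (th i).
  have : rt F (th i) by apply: (@root_of_cell xpredT _ _ _ FE).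
  rewrite FF.2 rmorph_prod /root horner_prod prodf_seq_eq0 => /hasP [s _ /=].
  by exists s.
have [cls clsP] := choice ex; exists cls => i s.
apply/idP/eqP => [rs|<- //]; apply: contrapT => /eqP ne.
have : coprimep (Fs (cls i)) (Fs s).
  apply: separable_coprime F_sep _; rewrite FF.2 (bigD1 (cls i))//= dvdp_mul2l.
    by rewrite (bigD1 s) 1?eq_sym//= dvdp_mulr.
  by apply: monic_neq0; case: FF => /(_ (cls i)) [].
rewrite -(coprimep_map iota) => /coprimep_root /(_ (clsP i)).
by move: rs; rewrite /root => ->.
Qed.

(** For each factor of [F], the factor of [G] that vanishes at the neighbour of
    one of its roots vanishes at the neighbours of exactly all of them: the
    conjugates of a root of one polynomial give equal values to each factor of
    the other one, and these values determine the cell. *)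
Lemma factor_matching g (Fs : 'I_g -> {poly k}) : irr_factorization v F Fs ->
  exists (cls : 'I_N -> 'I_g) (Gs : 'I_g -> {poly k}),
  [/\ irr_factorization v G Gs,
      forall s, map_poly iota (Fs s) = \prod_(i | cls i == s) ('X - (th i)%:P)
    & forall s, map_poly iota (Gs s) = \prod_(i | cls i == s) ('X - (be i)%:P)].
Proof.
move=> FF; have [cls clsP] := factor_cells FF.
have FsE s : map_poly iota (Fs s) = \prod_(i | cls i == s) ('X - (th i)%:P).
  have [Fm _] := FF.1 s.
  rewrite {1}(dvd_split th_inj FE Fm (factor_dvd s FF)).
  by apply: eq_bigl => i; rewrite clsP.
have [g' [Hs HH]] := irr_factorization_exists w_extends G_monic G_int.
have beinj := be_inj th_inj th_int disc_le near.
have exG s : exists H : {poly k}, [/\ H \is monic, irr_intpoly v H &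
    map_poly iota H = \prod_(i | cls i == s) ('X - (be i)%:P)].
  have [Fm FI] := FF.1 s; have [FO _ _ _] := FI.
  have Firr := irr_intpoly_irreducible w_extends Fm FI.
  have [x Fx] : exists x, rt (Fs s) x.
    by apply/closed_rootP; rewrite size_map_poly gtn_eqF// Firr.1.
  have [i0 /eqP is_ _] := root_in_cell (FsE s) Fx.
  have : rt G (be i0) by apply: (@root_of_cell xpredT _ _ _ GE).
  rewrite HH.2 rmorph_prod /root horner_prod prodf_seq_eq0 => /hasP [t _ /= Ht].
  have [Hm HI] := HH.1 t; have [HO _ _ _] := HI.
  have Hirr := irr_intpoly_irreducible w_extends Hm HI.
  exists (Hs t); split => //.
  have HE := dvd_split beinj GE Hm (factor_dvd t HH).
  rewrite HE; apply: eq_bigl => j; apply/idP/eqP => [Hj|js].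
    apply/eqP; rewrite -(be_in_cell th_inj th_int disc_le near j (fun i => cls i == s)).
    rewrite -(val_ev _ (FsE s)).
    rewrite (conj_val v_complete w_extends (Fs s) Hirr Hm HO Hj Ht).
    rewrite (val_ev _ (FsE s)) (be_in_cell th_inj th_int disc_le near i0 (fun i => cls i == s)).
    exact/eqP.
  rewrite -(th_in_cell th_inj th_int disc_le near j (fun i => rt (Hs t) (be i))).
  rewrite -(val_ev _ HE) (conj_val v_complete w_extends (Hs t) Firr Fm FO (y := th i0)).
  - by rewrite (val_ev _ HE) (th_in_cell th_inj th_int disc_le near i0 (fun i => rt (Hs t) (be i))).
  - by rewrite clsP js.
  - by rewrite clsP is_.
have [Gs GsP] := choice exG; exists cls, Gs; split => //; last by move=> s; case: (GsP s).
split; first by move=> s; case: (GsP s).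
apply: (map_poly_inj iota); rewrite rmorph_prod /= GE.
rewrite (partition_big cls xpredT)//=; apply: eq_bigr => s _.
by case: (GsP s) => _ _ ->.
Qed.

Section Cell.
Variables (g : nat) (cls : 'I_N -> 'I_g) (s : 'I_g) (f h : {poly k}).
Hypotheses (f_monic : f \is monic) (f_I : irr_intpoly v f) (f_F : f %| F).
Hypothesis fE : map_poly iota f = \prod_(i | cls i == s) ('X - (th i)%:P).
Hypotheses (h_monic : h \is monic) (h_I : irr_intpoly v h).
Hypothesis hE : map_poly iota h = \prod_(i | cls i == s) ('X - (be i)%:P).

Let f_int : f \is a polyOver (integers v). Proof. by case: f_I. Qed.
Let f_irr : irreducible_poly f.
Proof. exact: (irr_intpoly_irreducible w_extends f_monic f_I). Qed.
Let f_sep : separable_poly f. Proof. exact: dvdp_separable F_sep. Qed.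

Lemma degp_cell (p : {poly k}) (a : 'I_N -> K) :
  map_poly iota p = \prod_(i | cls i == s) ('X - (a i)%:P) ->
  degp p = #|[pred i | cls i == s]|.
Proof.
have -> : \prod_(i | cls i == s) ('X - (a i)%:P) =
    \prod_(i <- enum [pred i | cls i == s]) ('X - (a i)%:P) by rewrite big_enum.
move=> pE; by rewrite /degp -(size_map_poly iota) pE size_prod_XsubC -cardE.
Qed.

Lemma val_diff_cell i : cls i == s ->
  w (ev f^`() (th i)) = (\sum_(j | (cls j == s) && (j != i)) gap w th i j)%:E.
Proof.
move=> is_; rewrite -deriv_map fE deriv_prod_XsubC_cond// val_prod -sumEFin.
by apply: eq_bigr => j /andP[_ ji]; rewrite gapE.
Qed.

(** The discriminant of [F] is large enough to pay for all the conjugates of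
    [th i] at once. *)
Lemma near_cell i : cls i == s ->
  (w (ev f^`() (th i)) * (degp f)%:R%:E < w (th i - be i)%R + w (ev f^`() (th i)))%E.
Proof.
move=> is_; pose L j := \sum_(l | (cls l == s) && (l != j)) gap w th j l.
have Lcst j : cls j == s -> L j = L i.
  move=> js; apply/EFin_inj; rewrite -!val_diff_cell//.
  by apply: (conj_val v_complete w_extends _ f_irr) => //; exact: root_of_cell fE _.
have Lle j : L j <= different w th j.
  rewrite /different [leRHS](bigID (fun l => cls l == s))/= -[leLHS]addr0 lerD//.
    by rewrite /L; under eq_bigl do rewrite andbC.
  by apply: sumr_ge0 => l _; exact: gap_ge0.
have nL : L i * (degp f)%:R <= L i + (delta - different w th i).
  rewrite (degp_cell fE) mulr_natr -sumr_const (bigD1 i)//= lerD2l.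
  have h1 : \sum_(j | (j \in [pred i0 | cls i0 == s]) && (j != i)) L i <=
            \sum_(j | j != i) different w th j.
    rewrite [leRHS](bigID (fun l => cls l == s))/= -[leLHS]addr0 lerD//.
      under [leRHS]eq_bigl do rewrite andbC.
      by apply: ler_sum => j /andP[js _]; rewrite -(Lcst j js).
    by apply: sumr_ge0 => l _; exact: different_ge0.
  by apply: le_trans h1 _; have := disc_le; rewrite (bigD1 i)//=; lra.
rewrite val_diff_cell// -/(L i) -EFinM.
apply: (@lt_le_trans _ _ ((delta + 1 - different w th i)%:E + (L i)%:E)%E).
  by rewrite -EFinD lte_fin; lra.
by apply: leeD.
Qed.

Lemma diff_lt_near i : cls i == s -> (w (ev f^`() (th i)) < w (th i - be i)%R)%E.
Proof.
move=> is_; apply: lt_le_trans (near_half th_int disc_le near i).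
rewrite val_diff_cell// lte_fin; apply: (@le_lt_trans _ _ (different w th i)).
  rewrite /different [leRHS](bigID (fun l => cls l == s))/= -[leLHS]addr0 lerD//.
    by under eq_bigl do rewrite andbC.
  by apply: sumr_ge0 => l _; exact: gap_ge0.
by have := different_half th_int disc_le i; lra.
Qed.

Lemma degp_matched : degp h = degp f.
Proof. by rewrite (degp_cell fE) (degp_cell hE). Qed.

Lemma equiv_matched : okutsu_irr_equiv v iota w f h.
Proof.
split => //; [by case: h_I|exact: degp_matched|].
move=> x fx; have [phis Ff] := frame_exists v_complete v_discrete w_extends
  f_irr f_monic f_int f_sep fx.
exists phis => //=; apply: le_lt_trans (threshold_le v_complete w_extends f_irr
  f_monic f_int f_sep fx Ff) _.
have [i is_ xi] := root_in_cell fE fx; rewrite xi in fx *.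
rewrite /valat (val_ev _ hE) (near_sum_be th_inj th_int disc_le near (th_near w th delta i))//.
by rewrite -val_diff_cell//; exact: near_cell.
Qed.

(** Since [p - f] has degree less than [f], it takes at the root of [h] a value
    of the same valuation as at the root of [f], where it agrees with [p]; and
    the value of [f] at the root of [h] is known. *)
Lemma equiv_transfer (p : {poly k}) :
  okutsu_irr_equiv v iota w f p -> okutsu_irr_equiv v iota w h p.
Proof.
move=> [pm pO pd fp]; split => //; first by rewrite degp_matched.
move=> y hy; have [i is_ yi] := root_in_cell hE hy; rewrite yi.
have fx : rt f (th i) by exact: root_of_cell fE is_.
have bO := be_int th_int disc_le near i.
have [phis Ff thr] := fp _ fx.
have [Fh same] := frame_transport v_complete w_extends f_irr f_monic f_int f_sep fx bO
  degp_matched (diff_lt_near is_) Ff.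
exists phis => //=; rewrite same; set r := size phis in thr *.
have -> : frame_deg h phis r = frame_deg f phis r by rewrite /frame_deg degp_matched.
rewrite degp_matched /valat -(subrK f p) rmorphD hornerD.
apply: valD_gt.
  rewrite (val_near v_complete w_extends f_irr f_monic f_int f_sep fx bO).
  - by rewrite rmorphB hornerD hornerN (rootP fx) subr0.
  - exact: diff_lt_near.
  - have sp : size p = size f by rewrite !size_degp// pd.
    rewrite -(prednK (n := size f)) ?size_poly_gt0 ?monic_neq0// ltnS.
    apply/leq_sizeP => j; rewrite leq_eqVlt coefB => /predU1P[<-|].
      have := monicP pm; have := monicP f_monic; rewrite !lead_coefE sp => -> ->.
      by rewrite subrr.
    move=> fj; have fj' : (size f <= j)%N.
      by move: fj; rewrite prednK// size_poly_gt0 monic_neq0.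
    by rewrite !nth_default ?subrr// sp.
apply: le_lt_trans (threshold_le v_complete w_extends f_irr f_monic f_int f_sep fx Ff) _.
rewrite (val_ev _ fE) (near_sum_th th_inj th_int disc_le (be_near th_int disc_le near i))//.
by rewrite -val_diff_cell// [w (be i - _)]valB; exact: near_cell.
Qed.

End Cell.

Lemma om_transfer g (cls : 'I_N -> 'I_g) (Fs Gs : 'I_g -> {poly k}) (s t : 'I_g)
    (p : {poly k}) i j :
  irr_factorization v F Fs -> irr_factorization v G Gs ->
  (forall s, map_poly iota (Fs s) = \prod_(i | cls i == s) ('X - (th i)%:P)) ->
  (forall s, map_poly iota (Gs s) = \prod_(i | cls i == s) ('X - (be i)%:P)) ->
  p \is monic -> irr_intpoly v p -> degp p = degp (Fs s) ->
  s != t -> cls i == s -> cls j == t ->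
  (w (ev p (th j)) < w (ev p (th i)))%E -> (w (ev p (be j)) < w (ev p (be i)))%E.
Proof.
move=> FF GG FsE GsE pm pI pd st is_ jt.
have pirr := irr_intpoly_irreducible w_extends pm pI.
have [x px] : exists x, rt p x.
  by apply/closed_rootP; rewrite size_map_poly gtn_eqF// pirr.1.
pose S := [pred i | cls i == s]; pose T := [pred i | cls i == t].
have S0 : (0 < #|S|)%N by apply/card_gt0P; exists i.
have T0 : (0 < #|T|)%N by apply/card_gt0P; exists j.
have ST l : S l -> ~~ T l by move=> /= /eqP ->.
have TS l : T l -> ~~ S l by move=> /= /eqP ->; rewrite eq_sym.
have pn : degp p = #|S| by rewrite pd (degp_cell (FsE s)).
have pos n : (0 < n)%N -> (0 < n%:R%:E :> \bar rat)%E by rewrite lte_fin ltr0n.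
have iso s' t' : s' != t' ->
    isotropic w th [pred i | cls i == s'] [pred i | cls i == t'].
  move=> st' l l' /= ls' ls''; apply: EFin_inj.
  have [Fm FI] := FF.1 s'; have [FO _ _ _] := FI.
  have E a : cls a == s' -> w (ev (Fs t') (th a)) =
      (\sum_(j | cls j == t') gap w th a j)%:E.
    move=> as'; rewrite (val_ev _ (FsE t')) -sumEFin; apply: eq_bigr => b bt.
    rewrite gapE//; apply: contra st' => /eqP ba; move: as'; rewrite -ba => /eqP <-.
    by [].
  rewrite -!E//; apply: (conj_val v_complete w_extends _ _ Fm FO).
  - exact: (irr_intpoly_irreducible w_extends Fm FI).
  - exact: root_of_cell (FsE s') _.
  - exact: root_of_cell (FsE s') _.
have rec (a : 'I_N -> K) (Hs : 'I_g -> {poly k}) u l :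
    (forall u, Hs u \is monic /\ irr_intpoly v (Hs u)) ->
    (forall s, map_poly iota (Hs s) = \prod_(i | cls i == s) ('X - (a i)%:P)) ->
    cls l == u ->
    (#|[pred i | cls i == u]|%:R%:E * w (ev p (a l)) =
     #|S|%:R%:E * \sum_(i | cls i == u) w (x - a i)%R)%E.
  move=> HI HE lu; have [Hm Hi] := HI u.
  rewrite -pn -(degp_cell (HE u)) -(val_ev _ (HE u)).
  by apply: reciprocity => //; exact: root_of_cell (HE u) _.
have wS (a : 'I_N -> K) (Hs : 'I_g -> {poly k}) :
    (forall u, Hs u \is monic /\ irr_intpoly v (Hs u)) ->
    (forall s, map_poly iota (Hs s) = \prod_(i | cls i == s) ('X - (a i)%:P)) ->
    w (ev p (a i)) = (\sum_(i | cls i == s) w (x - a i)%R)%E.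
  move=> HI HE; have := rec a Hs s i HI HE is_.
  move=> e; apply/le_anti/andP; split.
    by rewrite -(lee_pmul2l _ (pos _ S0))// e.
  by rewrite -(lee_pmul2l _ (pos _ S0))// -e.
move=> lt; rewrite -(lte_pmul2l _ (pos _ T0))// (rec be Gs)//; last exact: GG.1.
rewrite (wS be Gs)//; last exact: GG.1.
apply: (separation_transfer th_inj th_int disc_le near ST (iso _ _ st) _ S0 T0).
  by apply: iso; rewrite eq_sym.
rewrite -(rec th Fs t j FF.1 FsE jt) -(wS th Fs FF.1 FsE).
by rewrite lte_pmul2l// pos.
Qed.

End Matched.
End FactorMatching.

(** * The theorem *)

Lemma congr_degp (k : fieldType) (v : valuation int k) n (F G : {poly k}) :
  F \is monic -> G \is monic -> congr_pow v n.+1 F G -> degp G = degp F.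
Proof.
have key (A B : {poly k}) : A \is monic -> B \is monic ->
    (forall i, (n.+1%:Z%:E <= v (A`_i - B`_i)%R)%E) -> (degp A <= degp B)%N.
  move=> Am Bm AB; rewrite leqNgt; apply/negP => ba; have := AB (degp A).
  rewrite [B`__]nth_default ?size_degp// subr0.
  by have := monicP Am; rewrite lead_coefE => ->; rewrite val1.
move=> Fm Gm FG; apply/eqP; rewrite eqn_leq; apply/andP; split.
  by apply: key => // i; rewrite valB; apply: (valmax_pow_ge (FG i)).
by apply: key => // i; apply: (valmax_pow_ge (FG i)).
Qed.

Theorem theorem3p14 (k : fieldType) (v : valuation int k)
  (v_discrete : discrete v)
  (v_complete : complete_val v)
  (v_loc_compact : locally_compact_val v)
  (kbar : closedFieldType) (iota : {rmorphism k -> kbar})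
  (kbar_alg : forall x : kbar, algebraicOver iota x)
  (w : valuation rat kbar) (w_extends : extends_val iota v w)
  (F G : {poly k})
  (F_monic : F \is monic) (F_int : F \in intpoly v) (F_sep : separable_poly F)
  (G_monic : G \is monic) (G_int : G \in intpoly v) (G_sep : separable_poly G)
  (delta : nat) (delta_def : v (disc F) = (delta%:Z)%:E)
  (FG : congr_pow v delta.+1 F G) :
  okutsu_equiv v iota w F G /\
  (forall (g : nat) (P : 'I_g -> {poly k}),
     om_factorization v iota w F P -> om_factorization v iota w G P).
Proof.
have [th th_inj FE] := separable_split iota F_monic F_sep.
have [b b_inj GbE] : exists2 b : 'I_(degp F) -> kbar, injective b &
    map_poly iota G = \prod_i ('X - (b i)%:P).
  by rewrite -(congr_degp F_monic G_monic FG); exact: separable_split.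
have th_int i : th i \in integers w.
  apply: (integers_root (monic_map iota F_monic) (map_integers w_extends F_int)).
  by apply: (@root_of_cell _ _ _ _ xpredT _ _ _ FE).
have disc_le := disc_sum_le w_extends F_monic th_inj th_int FE delta_def.
have FGw i : ((delta%:R + 1 : rat)%:E <=
    w (\prod_i ('X - (th i)%:P) - \prod_i ('X - (b i)%:P))`_i)%E.
  rewrite -FE -GbE -rmorphB coef_map coefB natr1 pmulrn (w_iota_ge w_extends).
  exact: (valmax_pow_ge (FG i)).
have [be [GE _ near]] := root_matching th_inj th_int disc_le FGw.
rewrite -GbE in GE.
have matching g Fs := @factor_matching _ _ v_complete _ _ _ w_extends F G _ th be
  _ G_monic G_int F_sep th_inj th_int disc_le near FE GE g Fs.
split.
  have [g [Fs FF]] := irr_factorization_exists w_extends F_monic F_int.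
  have [cls [Gs [GG FsE GsE]]] := matching _ _ FF.
  exists g, Fs, Gs; split => // s; have [Fm FI] := FF.1 s; have [Gm GI] := GG.1 s.
  exact: (equiv_matched v_complete v_discrete w_extends F_sep th_inj th_int disc_le
    near Fm FI (factor_dvd s FF) (FsE s) Gm GI (GsE s)).
move=> g P [Fs [FF PI FP] om].
have [cls [Gs [GG FsE GsE]]] := matching _ _ FF.
exists Gs; first split => // s.
  have [Fm FI] := FF.1 s; have [Gm GI] := GG.1 s.
  exact: (equiv_transfer v_complete w_extends F_sep th_inj th_int disc_le
    near Fm FI (factor_dvd s FF) (FsE s) (GsE s) (FP s)).
move=> s t st x y Gx Gy.
have [i is_ ->] := root_in_cell (GsE s) Gx; have [j jt ->] := root_in_cell (GsE t) Gy.
have [Pm PsI] := PI s; have [_ _ Pd _] := FP s.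
apply: (om_transfer v_complete w_extends th_inj th_int disc_le near FF GG FsE GsE
  Pm PsI Pd st is_ jt).
apply: (om _ _ st); first exact: (root_of_cell (FsE s) is_).
exact: (root_of_cell (FsE t) jt).
Qed.
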